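(* Let $t$ and $m \geq 2$ be integers with $t \geq m$, and let $\mathcal{H}$ be a family of connected $m$-uniform hypergraphs each having more than $t$ vertices. Then, as $r \to \infty$, \[ f_m(r, \mathcal{H}) \leq (1 + o_r(1))\, \frac{\binom{r-1}{m-1}}{\binom{t-1}{m-1}}. \]
   Context: Let $r \ge m \ge 2$ and $k$ be positive integers. An $m$-uniform hypergraph $G$ is an $(r,k)$-hypergraph if $V(G)$ can be partitioned into sets $V_1,\dots,V_r$ with $|V_i| \le k$ for all $i$ such that for every $m$-element subset $\{i_1,\dots,i_m\}$ of $[r]$ there is an edge $e \in E(G)$ with $|e \cap V_{i_j}| = 1$ for $1 \le j \le m$. For a family $\mathcal{H}$ of $m$-uniform hypergraphs, $f_m(r,\mathcal{H})$ is the minimum $k$ such that there exists an $m$-uniform $(r,k)$-hypergraph containing no member of $\mathcal{H}$ as a subgraph. $o_r(1)$ denotes a quantity tending to $0$ as $r \to \infty$. *)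

(* Defs.v *)
From mathcomp Require Import all_boot.

Set Implicit Arguments.
Unset Strict Implicit.
Unset Printing Implicit Defensive.

Record hypergraph := Hypergraph {
  vertex : finType;
  edges : {set {set vertex}}
}.

Definition uniform (m : nat) (G : hypergraph) : Prop :=
  forall e, e \in edges G -> #|e| = m.

Definition adjacent (G : hypergraph) : rel (vertex G) :=
  fun x y => [exists e in edges G, (x \in e) && (y \in e)].

Definition hconnected (G : hypergraph) : Prop :=
  forall x y : vertex G, connect (@adjacent G) x y.

(* Subgraphs are not required to be induced, and are taken up to isomorphism. *)
Definition has_subgraph (F G : hypergraph) : Prop :=
  exists2 f : vertex F -> vertex G,
    injective f & forall e, e \in edges F -> f @: e \in edges G.

Definition rk_hypergraph (m r k : nat) (G : hypergraph) : Prop :=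
  uniform m G /\
  exists V : 'I_r -> {set vertex G},
    [/\ forall i j, i != j -> [disjoint V i & V j],
        \bigcup_(i < r) V i = [set: vertex G],
        forall i, #|V i| <= k
      & forall I : {set 'I_r}, #|I| = m ->
          exists2 e, e \in edges G & forall i, i \in I -> #|e :&: V i| = 1].

Definition free_of (Hs : hypergraph -> Prop) (G : hypergraph) : Prop :=
  forall F, Hs F -> ~ has_subgraph F G.

Definition admissible (m r : nat) (Hs : hypergraph -> Prop) (k : nat) : Prop :=
  0 < k /\ exists2 G, rk_hypergraph m r k G & free_of Hs G.

(* [is_f m r Hs k] says that the minimum f_m(r, Hs) exists and equals k; it is
   a relation because for an arbitrary family there may be no admissible k. *)
Definition is_f (m r : nat) (Hs : hypergraph -> Prop) (k : nat) : Prop :=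
  admissible m r Hs k /\ forall l, admissible m r Hs l -> k <= l.

(* Main.v *)
(* A disjoint union of complete m-uniform hypergraphs on at most t vertices contains
   no connected hypergraph with more than t vertices. So it suffices to cover the
   m-subsets of [r] by blocks of size at most t in such a way that every point lies
   in at most (1 + o(1)) C(r-1,m-1) / C(t-1,m-1) blocks: the vertices of the
   hypergraph are the incident pairs (block, point), and V_i consists of the pairs
   with point i.

   Asymptotically optimal coverings (Rodl's theorem) come from a nibble made exact
   by blowing up. Given a system of t-cliques in which every edge (an m-set) lies in D
   cliques, replace each point by a copy of a vector space A over F_p having private
   coordinates for each pair (clique, edge of it), and from the lifts of each clique
   take a linear code that covers a fraction a/p of the lifts of each of its edges,
   namely those for which a functional in the private coordinates takes one of a given
   values. These events are exactly independent, so the uncovered lifts of edges and the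
   lifts of cliques made of them form a regular system again. With s = aD/p small,
   a step covers a fraction 1 - (1 - a/p)^D >= s - s^2 of the lifts at the cost of
   a perfect covering of a fraction s; iterating leaves an arbitrarily small fraction,
   and the remaining edges are used as blocks.

   To reach every large r with balanced degrees, put a good covering of [N] on the graph
   of each polynomial of degree less than m over Z/q, with q prime to (N-1)!, rotated by the
   linear coefficient of the polynomial. The m-subsets of [N] x Z/q with two points over
   the same element of [N] are a proportion O(1/N) of those through any point, and are
   used as blocks. *)
Require Import Defs.
From mathcomp Require Import all_boot all_order all_algebra.
From mathcomp Require Import zify ring lra.
Import Order.TTheory GRing.Theory Num.Theory.
Set Implicit Arguments.
Unset Strict Implicit.
Unset Printing Implicit Defensive.

Lemma card_bigcup_le (I T : finType) (P : {pred I}) (A : I -> {set T}) :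
  #|\bigcup_(i in P) A i| <= \sum_(i in P) #|A i|.
Proof.
elim/big_rec2: _ => [|i n B _ le_Bn]; first by rewrite cards0.
by apply: leq_trans (leq_card_setU _ _) _; rewrite leq_add2l.
Qed.

Lemma card_bigcup_leM (I T : finType) (P : {pred I}) (A : I -> {set T}) (n : nat) :
  (forall i, i \in P -> #|A i| <= n) -> #|\bigcup_(i in P) A i| <= #|P| * n.
Proof.
move=> leAn; apply: leq_trans (card_bigcup_le _ _) _.
by rewrite -sum_nat_const; apply: leq_sum.
Qed.

(** * Common complements over a prime field *)

Section CommonComplement.

Local Open Scope ring_scope.

Variables (X C J : finType) (p : nat).
Hypothesis p_pr : prime p.
Local Notation V := {ffun X -> {ffun C -> 'F_p}}.

Lemma mulrn_Fp (v : V) : v *+ p = 0.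
Proof.
apply/ffunP => i; apply/ffunP => c; rewrite !ffunMnE !ffunE.
by rewrite -mulr_natr pchar_Fp_0 // mulr0.
Qed.

Lemma mulrn_modp (v : V) c : v *+ (c %% p) = v *+ c.
Proof.
by rewrite [in RHS](divn_eq c p) mulrnDr mulnC mulrnA mulrn_Fp mul0rn add0r.
Qed.

Lemma mulrn_Fp_inv (v : V) c : (0 < c < p)%N ->
  exists c', v *+ c *+ c' = v.
Proof.
have p_gt0 := prime_gt0 p_pr.
move=> /andP[c_gt0 lt_cp]; have co_pc : coprime p c.
  by rewrite prime_coprime // gtnNdvd.
have [c' _ /dvdnP[b def_b]] := Bezoutl c (prime_gt0 p_pr).
(* [Bezoutl] makes [c' * c] congruent to -1 modulo [p]; the factor [p.-1] corrects the sign. *)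
exists (c' * p.-1)%N; rewrite -mulrnA.
have eq_p : (c * (c' * p.-1) + c' * c = p * (c' * c))%N.
  by rewrite -[in RHS](prednK p_gt0); ring.
apply: (addIr (v *+ (c' * c))); rewrite -mulrnDr eq_p mulrnA mulrn_Fp mul0rn.
move: def_b; rewrite (eqP co_pc) add1n => def_b.
by rewrite -mulrS def_b mulnC mulrnA mulrn_Fp mul0rn.
Qed.

Definition sumset (A B : {set V}) : {set V} :=
  (fun ab : V * V => ab.1 + ab.2) @: setX A B.

Lemma sumsetP (A B : {set V}) (v : V) :
  reflect (exists a b : V, [/\ a \in A, b \in B & v = a + b]) (v \in sumset A B).
Proof.
apply: (iffP imsetP) => [[[a b] /setXP[/= Aa Bb] ->] | [a [b [Aa Bb ->]]]].
  by exists a, b.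
by exists (a, b) => //; apply/setXP.
Qed.

(** Subgroups are subspaces over ['F_p]. A subgroup [W] meeting every [Ui i] only in 0 is enlarged
    one dimension at a time; once it has [p ^ n] elements, each sum [Ui i + W] has the size of [U]
    and so equals [U]. *)
Lemma common_complement (U : {set V}) (Ui : J -> {set V}) (n : nat) :
    zmod_closed (mem U) -> (forall i, zmod_closed (mem (Ui i))) ->
    (forall i, Ui i \subset U) -> (forall i, #|Ui i| * p ^ n = #|U|)%N ->
    (#|J| < p)%N ->
  exists2 W : {set V}, (#|W| <= p ^ n)%N &
    forall i u, u \in U -> exists2 w, w \in W & u - w \in Ui i.
Proof.
move=> [U0 UB] clUi sUi cardU lt_Jp.
have p_gt1 := prime_gt1 p_pr.
case: (pickP J) => [i0 _ | J0]; last first.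
  by exists set0 => [|i]; [rewrite cards0 | have := J0 i].
have clN (S : {set V}) : zmod_closed (mem S) -> forall v, v \in S -> - v \in S.
  by move=> [S0 SB] v Sv; rewrite -sub0r; apply: SB.
have clD (S : {set V}) : zmod_closed (mem S) ->
    forall u v, u \in S -> v \in S -> u + v \in S.
  move=> clS u v Su Sv; rewrite -[v]opprK; case: (clS) => _; apply=> //.
  exact: clN.
have clMn (S : {set V}) : zmod_closed (mem S) ->
    forall v c, v \in S -> v *+ c \in S.
  move=> clS v c Sv; elim: c => [|c IHc]; first by case: clS.
  by rewrite mulrS; apply: clD.
have clUiW (W : {set V}) i : zmod_closed (mem W) ->
    zmod_closed (mem (sumset (Ui i) W)).
  move=> clW; case: (clUi i) (clW) => Ui0 UiB [W0 WB]; split.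
    by apply/sumsetP; exists 0, 0; rewrite addr0.
  move=> _ _ /sumsetP[a [b [Ua Wb ->]]] /sumsetP[a' [b' [Ua' Wb' ->]]].
  apply/sumsetP; exists (a - a'), (b - b'); split; [exact: UiB | exact: WB |].
  by rewrite opprD addrACA.
(* Any vector of [U] outside all the [Ui i + W] can be added to [W]; there is one
   because fewer than [p] subgroups of index at least [p] do not cover [U]. *)
have grow k : (k <= n)%N -> exists W : {set V},
    [/\ zmod_closed (mem W), W \subset U, #|W| = (p ^ k)%N
      & forall i w, w \in W -> w \in Ui i -> w = 0].
  elim: k => [_|k IHk lt_kn].
    exists [set (0 : V)]; split.
    - by split=> [|u v]; rewrite !inE // => /eqP-> /eqP->; rewrite subr0.
    - by rewrite sub1set.
    - by rewrite cards1.
    - by move=> i w /set1P.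
  have [W [clW sWU cardW triv]] := IHk (ltnW lt_kn).
  pose bad := \bigcup_(i in [set: J]) sumset (Ui i) W.
  have card_bad : (#|bad| < #|U|)%N.
    have Ui0_gt0 i : (0 < #|Ui i|)%N.
      by apply/card_gt0P; exists 0; case: (clUi i).
    have bad_le : (#|bad| <= #|J| * (#|Ui i0| * p ^ k))%N.
      rewrite -[#|J|]cardsT; apply: card_bigcup_leM => i _; rewrite -cardW.
      have -> : #|Ui i0| = #|Ui i|.
        by apply/eqP; rewrite -(@eqn_pmul2r (p ^ n)) ?expn_gt0 ?prime_gt0 // !cardU.
      rewrite -cardsX; exact: leq_imset_card.
    apply: leq_ltn_trans bad_le _; rewrite -(cardU i0) mulnCA ltn_pmul2l //.
    apply: leq_trans (_ : p ^ k.+1 <= _)%N; last by rewrite leq_exp2l.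
    by rewrite expnS ltn_pmul2r // expn_gt0 prime_gt0.
  have /subsetPn[v Uv bad'v] : ~~ (U \subset bad).
    by apply: contraL card_bad => /subset_leq_card; rewrite -leqNgt.
  pose f (wc : V * 'I_p) := wc.1 + v *+ wc.2.
  (* Otherwise [v *+ c] would lie in [Ui i + W] and, [c] being invertible modulo [p], so would
     [v]. *)
  have inUiW i w (c : nat) : (0 < c < p)%N -> w \in W -> w + v *+ c \notin Ui i.
    move=> c_int Ww; apply: contra bad'v => Uwv; apply/bigcupP; exists i => //.
    have [c' {1}<-] := mulrn_Fp_inv v c_int.
    apply: clMn; first exact: clUiW.
    apply/sumsetP; exists (w + v *+ c), (- w); split=> //; first exact: clN.
    by rewrite addrC addKr.
  have f_inj : {in setX W setT &, injective f}.
    move=> [w c] [w' c'] /setXP[/= Ww _] /setXP[/= Ww' _]; rewrite /f /=.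
    wlog le_cc' : w w' c c' Ww Ww' / (c <= c')%N.
      move=> IH; case/orP: (leq_total c c') => [le_cc' | le_c'c]; first exact: IH.
      by move=> /esym/(IH w' w c' c Ww' Ww le_c'c).
    move=> eq_f; have eq_ww' : w - w' = v *+ (c' - c).
      by rewrite mulrnBr //; apply/eqP; rewrite subr_eq addrAC -subr_eq opprK eq_f addrC.
    have eq_cc' : c' = c :> nat.
      apply/eqP; rewrite eqn_leq le_cc' andbT leqNgt; apply/negP => lt_cc'.
      suff : w' - w + v *+ (c' - c) \notin Ui i0.
        by rewrite -eq_ww' addrA subrK subrr; case: (clUi i0) => ->.
      apply: inUiW; last by case: clW => _; apply.
      by rewrite subn_gt0 lt_cc' (leq_ltn_trans (leq_subr _ _)).
    move: eq_ww'; rewrite eq_cc' subnn => /subr0_eq ->.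
    by congr (_, _); apply: val_inj.
  exists (f @: setX W setT); split.
  - have p_gt0 := prime_gt0 p_pr; case: clW => W0 WB; split.
      by apply/imsetP; exists (0, Ordinal p_gt0); rewrite ?inE ?W0 //= /f /= mulr0n addr0.
    move=> _ _ /imsetP[[w c] /setXP[/= Ww _] ->] /imsetP[[w' c'] /setXP[/= Ww' _] ->].
    apply/imsetP; exists (w - w', Ordinal (ltn_pmod (c + (p - c')) p_gt0)).
      by apply/setXP; rewrite inE; split=> //; apply: WB.
    rewrite /f /= mulrn_modp mulrnDr mulrnBr ?(ltnW (ltn_ord c')) //.
    by rewrite mulrn_Fp sub0r opprD !addrA; congr (_ - _); rewrite addrAC.
  - apply/subsetP => _ /imsetP[[w c] /setXP[/= Ww _] ->]; rewrite /f /=.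
    by apply: clD; [split | exact: (subsetP sWU) | apply: clMn => //; split].
  - by rewrite card_in_imset // cardsX cardsT card_ord cardW expnSr.
  - move=> i _ /imsetP[[w c] /setXP[/= Ww _] ->]; rewrite /f /=.
    have [-> | c_neq0] := eqVneq (c : nat) 0%N.
      by rewrite mulr0n addr0; apply: triv.
    by move: (@inUiW i w c); rewrite lt0n c_neq0 ltn_ord => /(_ isT Ww)/negP.
have [W [[W0 WB] sWU cardW triv]] := grow n (leqnn n).
exists W => [|i u Uu]; first by rewrite cardW.
case: (clUi i) => Ui0 UiB.
have : u \in sumset (Ui i) W.
  suff /eqP -> : sumset (Ui i) W == U by [].
  rewrite eqEcard; apply/andP; split.
    apply/subsetP => _ /sumsetP[a [w [Ua Ww ->]]].
    by apply: clD; [split | exact: (subsetP (sUi i)) | exact: (subsetP sWU)].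
  rewrite card_in_imset ?cardsX ?cardW ?cardU // => -[a w] [a' w'].
  move=> /setXP[/= Ua Ww] /setXP[/= Ua' Ww'] /= eq_aw.
  have eq_w : w - w' = a' - a.
    by apply/eqP; rewrite subr_eq addrAC -subr_eq opprK [w + a]addrC eq_aw.
  have w0 : w - w' = 0 by apply: (triv i); [exact: WB | rewrite eq_w UiB].
  by move: eq_w; rewrite w0 => /esym/subr0_eq->; rewrite (subr0_eq w0).
case/sumsetP=> a [w [Ua Ww ->]]; exists w => //.
by rewrite addrK.
Qed.

End CommonComplement.

(** * Blow-ups: partial sections of [X * A -> X] *)

Section Lift.

Variables (X A : finType).
Implicit Types (S e : {set X}) (x y : {ffun X -> A}).

Definition agree S x y := [forall i in S, x i == y i].

Lemma agreeP S x y : reflect {in S, x =1 y} (agree S x y).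
Proof. exact: (iffP 'forall_in_eqP). Qed.

Lemma agreexx S x : agree S x x.
Proof. exact/agreeP. Qed.

Lemma agree_sym S x y : agree S x y = agree S y x.
Proof. by apply/agreeP/agreeP => eq_xy i /eq_xy. Qed.

Lemma card_agree S x : #|[set y | agree S y x]| = #|A| ^ (#|X| - #|S|).
Proof.
pose Fam i := if i \in S then pred1 (x i) else predT.
have -> : #|[set y | agree S y x]| = #|family Fam|.
  apply: eq_card => y; rewrite inE; apply/agreeP/familyP => yx i.
    by rewrite /Fam; case: ifP => // Si; rewrite inE yx.
  by move=> Si; have := yx i; rewrite /Fam Si inE => /eqP.
rewrite card_family foldrE big_map enumT -/(index_enum X).
rewrite (bigID (mem S)) /= big1 ?mul1n; last first.
  by move=> i Si; rewrite /Fam Si card1.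
rewrite (eq_bigr (fun=> #|A|)) => [|i /negPf nSi]; last by rewrite /Fam nSi.
rewrite prod_nat_const -(cardsC S) addKn; congr (_ ^ _).
by apply: eq_card => i; rewrite !inE.
Qed.

(** A partial section is given by a total function of which only the values on [S] count, that is,
    by a class of [agree S]. *)
Definition graph_on S x : {set X * A} := [set (i, x i) | i in S].

Lemma in_graph_on S x ia : (ia \in graph_on S x) = (ia.1 \in S) && (ia.2 == x ia.1).
Proof.
case: ia => i a /=; apply/imsetP/andP => [[j Sj [-> ->]] | [Si /eqP ->]].
  by rewrite Sj eqxx.
by exists i.
Qed.

Lemma subset_graph_on S S' x y :
  (graph_on S x \subset graph_on S' y) = (S \subset S') && agree S x y.
Proof.
apply/subsetP/andP => [sub | [/subsetP sSS' /agreeP xy] [i a]].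
  by split; [apply/subsetP | apply/agreeP] => i Si;
    have := sub (i, x i); rewrite !in_graph_on Si eqxx => /(_ isT)/andP[] // _ /eqP.
by rewrite !in_graph_on => /andP[/= Si /eqP->]; rewrite sSS' ?xy /=.
Qed.

Lemma eq_graph_on S x y : agree S x y -> graph_on S x = graph_on S y.
Proof.
by move=> xy; apply/eqP; rewrite eqEsubset !subset_graph_on subxx xy agree_sym.
Qed.

Lemma proj_graph_on S x : [set ia.1 | ia in graph_on S x] = S.
Proof. by rewrite -imset_comp imset_id. Qed.

Lemma graph_on_agree S x y : graph_on S x = graph_on S y -> agree S x y.
Proof. by move/eqP; rewrite eqEsubset subset_graph_on => /andP[/andP[]]. Qed.

Lemma card_graph_on S x : #|graph_on S x| = #|S|.
Proof. by rewrite card_in_imset // => i j _ _ []. Qed.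

Lemma sub_graph_on (s : {set X * A}) S x : s \subset graph_on S x ->
  exists2 e : {set X}, e \subset S & s = graph_on e x.
Proof.
move=> /subsetP sub; exists [set i | (i, x i) \in s].
  by apply/subsetP => i; rewrite inE => /sub; rewrite in_graph_on => /andP[].
apply/setP => -[i a]; rewrite in_graph_on inE /=; apply/idP/andP => [sia | [? /eqP-> //]].
by have := sub _ sia; rewrite in_graph_on => /andP[_ /eqP/= <-]; rewrite sia eqxx.
Qed.

(** The fibres of [graph_on S] are the classes of [agree S], all of one size, so counting lifts
    reduces to counting total functions. *)
Lemma card_graph_on_image S (P : {set {ffun X -> A}}) :
    (forall x y, agree S x y -> x \in P -> y \in P) ->
  #|[set graph_on S x | x in P]| * #|A| ^ (#|X| - #|S|) = #|P|.
Proof.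
move=> clP; rewrite -[RHS]sum1_card (partition_big_imset (graph_on S)) /=.
rewrite -sum_nat_const; apply: eq_bigr => _ /imsetP[x Px ->].
rewrite sum1dep_card -(card_agree S x); apply: eq_card => y; rewrite !inE.
apply/idP/andP => [yx | [_ /eqP/graph_on_agree //]].
by rewrite (eq_graph_on yx) eqxx (clP x) // agree_sym.
Qed.

Lemma card_graphs_on (E : {set {set X}}) (m : nat) : 0 < #|A| ->
    {in E, forall e, #|e| = m} ->
  #|\bigcup_(e in E) [set graph_on e x | x in [set: {ffun X -> A}]]| = #|E| * #|A| ^ m.
Proof.
move=> A_gt0 cardE; rewrite -sum1_card -sum_nat_const.
rewrite (partition_big (fun s : {set X * A} => [set ia.1 | ia in s]) (mem E)) /= =>
  [|s]; last first.
  by case/bigcupP=> e Ee /imsetP[x _ ->]; rewrite proj_graph_on.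
apply: eq_bigr => e Ee; rewrite sum1dep_card -(cardE e Ee).
apply/eqP; rewrite -(@eqn_pmul2r (#|A| ^ (#|X| - #|e|))) ?expn_gt0 ?A_gt0 //.
rewrite -expnD subnKC ?max_card // -card_ffun.
have cardeT := @card_graph_on_image e setT; rewrite cardsT in cardeT.
rewrite -cardeT => [|x y _ _]; last by rewrite inE.
rewrite eqn_pmul2r ?expn_gt0 ?A_gt0 //; apply/eqP/eq_card => s; rewrite !inE.
apply/andP/imsetP => [[/bigcupP[e' Ee' /imsetP[x _ ->]]] | [x _ ->]].
  by rewrite proj_graph_on => /eqP->; exists x; rewrite ?inE.
rewrite proj_graph_on eqxx; split=> //; apply/bigcupP; exists e => //.
by apply: imset_f; rewrite inE.
Qed.

End Lift.

(** * Independent linear conditions on lifts *)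

Section Avoid.

Local Open Scope ring_scope.

Variables (X : finType) (p : nat).
Hypothesis p_pr : prime p.

Definition fsum (S : {set X}) (y : {ffun X -> 'F_p}) : 'F_p := \sum_(i in S) y i.

(** Translating one coordinate in [S] outside [S0] permutes the values of the sum, so all [p] values
    are taken equally often. *)
Lemma card_agree_sum_avoid (S0 S : {set X}) (x : {ffun X -> 'F_p})
    (T : {set 'F_p}) : ~~ (S \subset S0) ->
  (#|[set y | agree S0 y x && (fsum S y \notin T)]| * p =
   p ^ (#|X| - #|S0|) * (p - #|T|))%N.
Proof.
case/subsetPn => v Sv S0v.
pose fib c := [set y : {ffun X -> 'F_p} | agree S0 y x & fsum S y == c].
have card_fib c : (#|fib c| = #|fib 0%R|)%N.
  pose tr (d : 'F_p) (y : {ffun X -> 'F_p}) := [ffun i => y i + d *+ (i == v)].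
  have trK d : cancel (tr d) (tr (- d)).
    by move=> y; apply/ffunP => i; rewrite !ffunE mulNrn addrK.
  have tr_fib d c' y : y \in fib c' -> tr d y \in fib (c' + d).
    rewrite !inE => /andP[/agreeP yx /eqP <-]; apply/andP; split.
      apply/agreeP => i S0i; rewrite ffunE yx //.
      by case: eqP S0i => [-> | _ _]; [rewrite (negPf S0v) | rewrite addr0].
    apply/eqP; rewrite /fsum (eq_bigr (fun i => y i + d *+ (i == v))) => [|i _]; last first.
      by rewrite ffunE.
    rewrite big_split /=; congr (_ + _); rewrite (bigD1 v) //= eqxx big1 ?addr0 //.
    by move=> i /andP[_ /negPf->].
  apply/eqP; rewrite eqn_leq; apply/andP; split.
    rewrite -(card_imset _ (can_inj (trK (- c)))); apply: subset_leq_card.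
    by apply/subsetP => _ /imsetP[y /(tr_fib (- c)) + ->]; rewrite subrr.
  rewrite -(card_imset _ (can_inj (trK c))); apply: subset_leq_card.
  by apply/subsetP => _ /imsetP[y /(tr_fib c) + ->]; rewrite add0r.
have card_in (B : {set 'F_p}) :
    (#|[set y | agree S0 y x && (fsum S y \in B)]| = #|B| * #|fib 0%R|)%N.
  rewrite -sum_nat_const -sum1dep_card (partition_big (fsum S) (mem B)) /=; last first.
    by move=> y /andP[].
  apply: eq_bigr => c Bc; rewrite -(card_fib c) sum1dep_card; apply: eq_card => y.
  by rewrite !inE; case: eqP => [->|]; rewrite ?Bc ?andbT ?andbF.
have cardCT : #|~: T| = (p - #|T|)%N by rewrite -[X in (X - _)%N](card_Fp p_pr) -(cardsC T) addKn.
have -> : (#|[set y | agree S0 y x && (fsum S y \notin T)]| =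
           (p - #|T|) * #|fib 0%R|)%N.
  by rewrite -cardCT -card_in; apply: eq_card => y; rewrite !inE.
have := card_in setT; rewrite cardsT card_Fp // => cardT.
rewrite -mulnA [(_ * p)%N]mulnC -cardT mulnC; congr (_ * _)%N.
have := card_agree S0 x; rewrite card_Fp // => <-.
by apply: eq_card => y; rewrite !inE andbT.
Qed.

Lemma card_agree_Fp (S0 : {set X}) (x : {ffun X -> 'F_p}) :
  (#|[set y | agree S0 y x]| = p ^ (#|X| - #|S0|))%N.
Proof. by rewrite card_agree card_Fp. Qed.

Variable C : finType.

Definition hash (S : {set X}) (c : C) (x : {ffun X -> {ffun C -> 'F_p}}) : 'F_p :=
  \sum_(i in S) x i c.

(* Condition [c] involves only the coordinates [y _ c], and it has a free variable
   outside [S0]: the conditions are exactly independent, even when [y] is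
   prescribed on [S0]. *)
Lemma count_avoid (S0 : {set X}) (x : {ffun X -> {ffun C -> 'F_p}})
    (act : {set C}) (S : C -> {set X}) (T : {set 'F_p}) :
    (forall c, c \in act -> ~~ (S c \subset S0)) ->
  (#|[set y | agree S0 y x & [forall c in act, hash (S c) c y \notin T]]|
     * p ^ #|act| = p ^ (#|C| * (#|X| - #|S0|)) * (p - #|T|) ^ #|act|)%N.
Proof.
move=> nsub.
pose xc c := [ffun i => x i c].
pose Fam c := [set u : {ffun X -> 'F_p} |
  agree S0 u (xc c) && ((c \in act) ==> (fsum (S c) u \notin T))].
(* Transposing [y] turns the set into a product over [c], one factor per coordinate. *)
pose tr (y : {ffun X -> {ffun C -> 'F_p}}) := [ffun c => [ffun i => y i c]].
pose rt (z : {ffun C -> {ffun X -> 'F_p}}) := [ffun i => [ffun c => z c i]].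
have trK : cancel tr rt by move=> y; apply/ffunP => i; apply/ffunP => c; rewrite !ffunE.
have rtK : cancel rt tr by move=> y; apply/ffunP => i; apply/ffunP => c; rewrite !ffunE.
have -> : #|[set y | agree S0 y x & [forall c in act, hash (S c) c y \notin T]]|
        = #|family (fun c => mem (Fam c))|.
  rewrite -(card_imset _ (can_inj trK)); apply: eq_card => z.
  rewrite -[z]rtK (mem_imset _ _ (can_inj trK)) inE.
  move: (rt z) => y {z}.
  have fsumE c : fsum (S c) (tr y c) = hash (S c) c y.
    by apply: eq_bigr => i _; rewrite !ffunE.
  apply/andP/familyP => [[/agreeP yx /forall_inP avoid] c | yFam].
    rewrite /= inE fsumE; apply/andP; split; last exact/implyP/avoid.
    by apply/agreeP => i Si; rewrite !ffunE yx.
  split.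
    apply/agreeP => i Si; apply/ffunP => c.
    by have := yFam c; rewrite /= inE => /andP[/agreeP/(_ i Si)]; rewrite !ffunE.
  apply/forall_inP => c actc; have := yFam c; rewrite /= inE fsumE actc.
  by case/andP.
rewrite card_family foldrE big_map enumT -/(index_enum C) /=.
have prodE (n : nat) : (n ^ #|act| = \prod_(c in C) (if c \in act then n else 1))%N.
  by rewrite -big_mkcondr /= prod_nat_const.
rewrite !prodE [(#|C| * _)%N]mulnC expnM -prod_nat_const -!big_split /=.
apply: eq_bigr => c _; rewrite /Fam; case: ifP => /= actc.
  by rewrite card_agree_sum_avoid // nsub.
by rewrite !muln1 -(card_agree_Fp S0 (xc c)); apply: eq_card => u; rewrite !inE andbT.
Qed.

End Avoid.

(* By the cardinality bound, a family [W] restricts bijectively to every [m]-subset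
   of [K] when [#|K| >= m]: it is an orthogonal array of strength [m] and index 1. *)
Definition strong_array (m t : nat) (A : finType) : Prop :=
  forall (X : finType) (K : {set X}), #|K| <= t ->
  exists2 W : {set {ffun X -> A}}, #|W| <= #|A| ^ m
    & forall (e : {set X}) (y : {ffun X -> A}), e \subset K -> #|e| = m ->
      exists2 w, w \in W & agree e y w.

Lemma strong_array_unit m t : strong_array m t unit.
Proof.
move=> X K _; exists [set [ffun=> tt]]; first by rewrite cards1 expn_gt0 card_unit.
move=> e y _ _; exists [ffun=> tt]; first exact: set11.
by apply/agreeP => i _; case: (y i); rewrite ffunE.
Qed.

Lemma strong_array_prod m t (A A' : finType) :
  strong_array m t A -> strong_array m t A' -> strong_array m t (A * A')%type.
Proof.
move=> arrA arrA' X K leKt.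
have [W leW codeW] := arrA X K leKt; have [W' leW' codeW'] := arrA' X K leKt.
pose f (ww : {ffun X -> A} * {ffun X -> A'}) := [ffun i => (ww.1 i, ww.2 i)].
exists (f @: setX W W').
  by apply: leq_trans (leq_imset_card _ _) _; rewrite cardsX card_prod expnMn leq_mul.
move=> e y seK cardE.
have [w Ww /agreeP yw] := codeW e [ffun i => (y i).1] seK cardE.
have [w' Ww' /agreeP yw'] := codeW' e [ffun i => (y i).2] seK cardE.
exists (f (w, w')); first by apply: imset_f; apply/setXP.
apply/agreeP => i ei; rewrite ffunE /=.
by have := yw i ei; have := yw' i ei; rewrite !ffunE => <- <-; case: (y i).
Qed.

(** * Linear codes from common complements *)

Section LinearCodes.

Local Open Scope ring_scope.

Variables (m t p : nat).
Hypothesis p_pr : prime p.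
Hypothesis lt_p : ('C(t, m) < p)%N.

Definition msub (X : finType) (K : {set X}) : {set {set X}} :=
  [set e : {set X} | e \subset K & #|e| == m].

Lemma card_msub (X : finType) (K : {set X}) : #|msub K| = 'C(#|K|, m).
Proof. exact: cards_draws. Qed.

Lemma msubP (X : finType) (K e : {set X}) :
  reflect (e \subset K /\ #|e| = m) (e \in msub K).
Proof. by rewrite inE; apply: (iffP andP) => -[? /eqP]. Qed.

Lemma agree0B (X C : finType) (e : {set X}) (x y : {ffun X -> {ffun C -> 'F_p}}) :
  agree e x 0 -> agree e y 0 -> agree e (x - y) 0.
Proof.
move=> /agreeP x0 /agreeP y0; apply/agreeP => i ei.
by rewrite !ffunE x0 // y0 // ffunE subr0.
Qed.

Lemma card_msub_lt (X : finType) (K : {set X}) : (#|K| <= t)%N ->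
  (#|{: {e : {set X} | e \in msub K}}| < p)%N.
Proof.
move=> leKt; rewrite card_sig; apply: leq_ltn_trans lt_p.
apply: leq_trans (leq_bin2l _ leKt); rewrite -card_msub.
by apply: subset_leq_card; apply/subsetP => e; rewrite !inE.
Qed.

(** The functions vanishing on an [m]-subset [e] of [K] form a subgroup of index [#|A| ^ m], with
    [A] the alphabet. A common complement of these subgroups meets all their cosets, so some member
    agrees with [y] on [e]. *)
Lemma strong_array_Fp (C : finType) : strong_array m t {ffun C -> 'F_p}.
Proof.
move=> X K leKt.
pose Ui (e : {e : {set X} | e \in msub K}) :=
  [set y : {ffun X -> {ffun C -> 'F_p}} | agree (val e) y 0].
have := @common_complement X C _ p p_pr setT Ui (#|C| * m).
case=> [|e|e|e||W leW codeW].
- by split=> [|u v]; rewrite !inE.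
- by split=> [|u v]; rewrite !inE ?agreexx //; apply: agree0B.
- exact: subsetT.
- rewrite card_agree cardsT !card_ffun card_Fp // -expnM -expnD -expnM.
  have [/= _ card_e] := msubP _ _ (valP e).
  by rewrite card_e -mulnDr subnK // -card_e max_card.
- exact: card_msub_lt.
exists W; first by rewrite card_ffun card_Fp // -expnM.
move=> e y seK card_e.
have eK : e \in msub K by apply/msubP.
have [w Ww] := codeW (exist _ e eK) y (in_setT _).
rewrite inE => /agreeP /= yw; exists w => //; apply/agreeP => i ei.
by have := yw i ei; rewrite !ffunE => /subr0_eq.
Qed.

Hypothesis m_gt0 : (0 < m)%N.

Variables (X I : finType) (l : I) (K : {set X}).
Hypothesis leKt : (#|K| <= t)%N.
Local Notation C := (I * {set X})%type.
Local Notation V := {ffun X -> {ffun C -> 'F_p}}.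

Lemma hashD S (c : C) (x y : V) : hash S c (x + y) = hash S c x + hash S c y.
Proof. by rewrite -big_split; apply: eq_bigr => i _; rewrite !ffunE. Qed.

Lemma hashN S (c : C) (x : V) : hash S c (- x) = - hash S c x.
Proof. by rewrite -sumrN; apply: eq_bigr => i _; rewrite !ffunE. Qed.

Lemma hash_agree S (c : C) (x y : V) : agree S x y -> hash S c x = hash S c y.
Proof. by move=> /agreeP xy; apply: eq_bigr => i Si; rewrite xy. Qed.

Lemma card_hash_eq (S0 : {set X}) (x : V) (z : 'F_p) (Es : {set {set X}}) :
    (forall e, e \in Es -> ~~ (e \subset S0)) ->
  (#|[set y : V | agree S0 y x & [forall e in Es, hash e (l, e) y == z]]| * p ^ #|Es|
    = p ^ (#|{: C}| * (#|X| - #|S0|)))%N.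
Proof.
move=> nsub.
have pair_inj : injective (pair l : {set X} -> C) by move=> e e' [].
(* Hashing to [z] means avoiding its complement, which leaves one value out of [p]. *)
have := @count_avoid X p p_pr C S0 x (pair l @: Es) snd [set~ z].
rewrite card_imset // => card_avoid.
rewrite -[RHS]muln1 -(exp1n #|Es|).
have <- : (p - #|[set~ z]| = 1)%N by rewrite cardsC1 card_Fp // -subn1 subKn ?prime_gt0.
rewrite -card_avoid => [|_ /imsetP[e Ee ->]]; last exact: nsub.
congr (_ * _)%N; apply: eq_card => y; rewrite !inE; congr (_ && _).
apply/forall_inP/forall_inP => [hy _ /imsetP[e Ee ->] | hy e Ee].
  by rewrite !inE negbK hy.
by have := hy (l, e); rewrite !inE negbK; apply; apply: imset_f.
Qed.

Lemma nsub_msub e e' : e \in msub K -> e' \in msub K -> e' != e -> ~~ (e' \subset e).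
Proof.
move=> /msubP[_ card_e] /msubP[_ card_e']; apply: contra => sub.
by rewrite eqEcard sub card_e card_e' /= leqnn.
Qed.

Lemma hash_extend (S0 : {set X}) (x : V) (z : 'F_p) (Es : {set {set X}}) :
    (forall e, e \in Es -> ~~ (e \subset S0)) ->
  exists2 y : V, agree S0 y x & forall e, e \in Es -> hash e (l, e) y = z.
Proof.
move=> nsub; have := card_hash_eq x z nsub.
case: (set_0Vmem [set y : V | agree S0 y x & [forall e in Es, hash e (l, e) y == z]]).
  move=> ->; rewrite cards0 mul0n => /esym/eqP.
  by rewrite expn_eq0 (gtn_eqF (prime_gt0 p_pr)).
case=> y; rewrite inE => /andP[yx /'forall_in_eqP hy] _.
by exists y.
Qed.

(* For [z = 0]: the vectors of [U] that vanish on [e] form a subgroup of size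
   independent of [e], so all of these subgroups have a common complement [W] in [U].
   The other values of [z] are reached by a translation. *)
Lemma hash_code (z : 'F_p) :
  exists2 W : {set V}, (#|W| * p <= (p ^ #|{: C}|) ^ m)%N
    & forall (e : {set X}) y, e \subset K -> #|e| = m -> hash e (l, e) y = z ->
      exists2 w, w \in W & agree e y w.
Proof.
pose U := [set y : V | [forall e in msub K, hash e (l, e) y == 0]].
pose Ui (e : {e : {set X} | e \in msub K}) := [set y in U | agree (val e) y 0].
have clU : zmod_closed (mem U).
  split=> [|x y]; rewrite ?inE.
    apply/'forall_in_eqP => e _; apply: big1 => i _; by rewrite !ffunE.
  move=> /'forall_in_eqP x0 /'forall_in_eqP y0; apply/'forall_in_eqP => e Ke.
  by rewrite hashD hashN x0 // y0 // subr0.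
have C_gt0 : (0 < #|{: C}|)%N by apply/card_gt0P; exists (l, set0).
have nsub0 e : e \in msub K -> ~~ (e \subset set0).
  by case/msubP=> _ card_e; rewrite subset0 -card_gt0 card_e.
have cardU : (#|U| * p ^ #|msub K| = p ^ (#|{: C}| * #|X|))%N.
  have := @card_hash_eq set0 0 0 (msub K) nsub0; rewrite cards0 subn0 => <-.
  congr (_ * _)%N; apply: eq_card => y; rewrite !inE.
  suff -> : agree set0 y 0 by [].
  by apply/agreeP => i; rewrite inE.
(* A vector vanishing on [e] satisfies the hash condition of [e] automatically; hence the index of
   [Ui e] in [U] has one factor [p] less than for the full space, and this makes the code
   cheaper. *)
have := @common_complement X C _ p p_pr U Ui (#|{: C}| * m).-1 clU.
case=> [e|e|e||W leW codeW].
- split=> [|u v]; rewrite ![_ \in mem (Ui e)]inE ?agreexx ?andbT; first by case: clU.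
  by move=> /andP[Uu u0] /andP[Uv v0]; rewrite agree0B // andbT; case: clU => _; apply.
- by apply/subsetP => y; rewrite inE => /andP[].
- have eK := valP e; have [_ card_e] := msubP _ _ eK.
  have nsub e' : e' \in msub K :\ val e -> ~~ (e' \subset val e).
    by rewrite in_setD1 => /andP[ne_e' Ke']; apply: nsub_msub.
  have := card_hash_eq 0 0 nsub.
  have -> : [set y : V | agree (val e) y 0 &
      [forall e' in msub K :\ val e, hash e' (l, e') y == 0]] = Ui e.
    apply/setP => y; rewrite !inE [RHS]andbC; case: (boolP (agree _ _ _)) => //= y0.
    apply/'forall_in_eqP/'forall_in_eqP => hy e' Ke'; last first.
      by apply: hy; case/setD1P: Ke'.
    have [-> | ne_e'] := eqVneq e' (val e); last by apply: hy; rewrite in_setD1 ne_e'.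
    by rewrite (hash_agree _ y0); apply: big1 => i _; rewrite !ffunE.
  move: cardU; rewrite (cardsD1 (val e)) eK add1n card_e => cardU cardUi.
  apply/eqP; rewrite -(@eqn_pmul2r (p ^ #|msub K :\ val e|.+1)) ?expn_gt0 ?prime_gt0 //.
  rewrite cardU expnSr mulnACA mulnC -expnSr cardUi.
  rewrite mulnC prednK ?muln_gt0 ?C_gt0 // -expnD -mulnDr subnK //.
  by rewrite -card_e max_card.
- exact: card_msub_lt.
(* Translation by [xz], all of whose hashes are [z], carries [U] to the solutions for the value
   [z]. *)
have [xz _ hxz] := @hash_extend set0 0 z (msub K) nsub0.
exists ((fun w : V => w + xz) @: W).
  apply: leq_trans (_ : p ^ (#|{: C}| * m).-1 * p <= _)%N.
    by rewrite leq_mul2r (leq_trans (leq_imset_card _ _)) ?orbT.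
  by rewrite -expnSr prednK ?muln_gt0 ?C_gt0 // expnM.
move=> e y seK card_e hy.
have Ke : e \in msub K by apply/msubP.
have nsub e' : e' \in msub K :\ e -> ~~ (e' \subset e).
  by rewrite in_setD1 => /andP[ne_e' Ke']; apply: nsub_msub.
(* Only the values of [y] on [e] matter; off [e] they are changed so that the other hashes vanish
   too. *)
have [u uy hu] := hash_extend (y - xz) 0 nsub.
have Uu : u \in U.
  rewrite inE; apply/'forall_in_eqP => e' Ke'.
  have [-> | ne_e'] := eqVneq e' e; last by apply: hu; rewrite in_setD1 ne_e'.
  by rewrite (hash_agree _ uy) hashD hashN hy hxz // subrr.
have [w Ww] := codeW (exist _ e Ke) u Uu.
rewrite inE => /andP[_ /agreeP /= uw]; exists (w + xz); first exact: imset_f.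
apply/agreeP => i ei; have := uw i ei; rewrite !ffunE => /subr0_eq.
by move/agreeP: uy => -> //; rewrite !ffunE => <-; rewrite subrK.
Qed.

End LinearCodes.

(** * The nibble *)

(* The cliques form an indexed family, so that the same [t]-set may occur
   several times; degrees count indices. *)
Definition clique_system (m t : nat) (X I : finType) (E : {set {set X}})
    (J : {set I}) (kap : I -> {set X}) (D : nat) : Prop :=
  [/\ forall e, e \in E -> #|e| = m,
      forall j, j \in J -> #|kap j| = t,
      forall j, j \in J -> msub m (kap j) \subset E
    & forall e, e \in E -> #|[set j in J | e \subset kap j]| = D].

(** Double counting of the pairs of a clique index and an edge inside the clique. *)
Lemma clique_system_count m t (X I : finType) (E : {set {set X}}) (J : {set I})
    (kap : I -> {set X}) (D : nat) :
  clique_system m t E J kap D -> #|J| * 'C(t, m) = #|E| * D.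
Proof.
case=> cardE cardK subE degE.
rewrite -sum_nat_const -[RHS]sum_nat_const.
rewrite -[RHS](eq_bigr _ (fun e Ee => degE e Ee)).
under [RHS]eq_bigr do rewrite -sum1dep_card big_mkcondr.
rewrite /= exchange_big /=; apply: eq_bigr => j Jj.
rewrite -big_mkcondr /= sum1dep_card -(cardK j Jj) -card_msub.
apply: eq_card => e; rewrite !inE andbC; apply/andP/andP => [[/eqP ce sub] | [Ee sub]].
  by split=> //; apply: (subsetP (subE j Jj)); apply/msubP.
by rewrite sub (cardE e Ee) eqxx.
Qed.

Section Nibble.

Variables (m t p : nat) (T : {set 'F_p}).
Hypotheses (p_pr : prime p) (lt_p : 'C(t, m) < p) (m_gt0 : 0 < m).
Hypothesis ltTp : #|T| < p.

Variables (X I : finType) (E : {set {set X}}) (J : {set I}) (kap : I -> {set X}).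
Variable D : nat.
Hypothesis sysE : clique_system m t E J kap D.
Hypothesis D_gt0 : 0 < D.

Local Notation C := (I * {set X})%type.
Local Notation A := {ffun C -> 'F_p}.
Local Notation V := {ffun X -> A}.

(* The alphabet [A] has one coordinate for each pair of a clique index [j] and a set
   [e]. A lift of [e] is covered, by the code of clique [j], exactly when
   its hash for the coordinate [(j, e)] falls in [T]; thus a lift escapes with
   density [(1 - #|T| / p) ^ D]. *)
Let Je (e : {set X}) := [set j in J | e \subset kap j].

Definition alive e := [set x : V | [forall j in Je e, hash e (j, e) x \notin T]].

Definition left_edges := \bigcup_(e in E) [set graph_on e x | x in alive e].

(** Indexing by a whole function repeats each lifted clique once for every extension outside
    [kap j]; this is harmless, since degrees count indices. *)
Definition left_cliques :=
  [set jx : I * V | (jx.1 \in J) && [forall e in msub m (kap jx.1), jx.2 \in alive e]].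

Let cardA : #|{: A}| = p ^ #|{: C}|.
Proof. by rewrite card_ffun card_Fp. Qed.

Let cardA_gt0 : 0 < #|{: A}|.
Proof. by rewrite cardA expn_gt0 prime_gt0. Qed.

Lemma alive_agree e x y : agree e x y -> x \in alive e -> y \in alive e.
Proof.
rewrite !inE => xy /forall_inP x_alive; apply/forall_inP => j Jj.
by rewrite -(hash_agree _ xy) x_alive.
Qed.

Lemma card_alive e : e \in E ->
  #|[set graph_on e x | x in alive e]| * p ^ D = #|{: A}| ^ m * (p - #|T|) ^ D.
Proof.
case: sysE => cardE _ _ degE Ee.
have card_e := cardE e Ee.
have := card_graph_on_image (@alive_agree e); rewrite card_e => card_im.
apply/eqP; rewrite -(@eqn_pmul2r (#|{: A}| ^ (#|X| - m))) ?expn_gt0 ?cardA_gt0 //.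
rewrite mulnAC card_im [X in _ == X]mulnAC -expnD subnKC -?card_e ?max_card //.
have pair_inj : injective (fun j : I => (j, e) : C) by move=> j j' [].
have := @count_avoid X p p_pr C set0 0%R ((fun j => (j, e)) @: Je e) snd T.
rewrite card_imset // degE // cards0 subn0 cardA -expnM => <-; last first.
  by move=> _ /imsetP[j _ ->] /=; rewrite subset0 -card_gt0 card_e.
apply/eqP; congr (_ * _); apply: eq_card => y; rewrite !inE.
suff -> : agree set0 y 0%R.
  apply/forall_inP/forall_inP => [hy _ /imsetP[j Jj ->] | hy j Jj]; first exact: hy.
  by apply: (hy (j, e)); apply: imset_f.
by apply/agreeP => i; rewrite inE.
Qed.

Lemma card_left_edges :
  #|left_edges| * p ^ D <= #|E| * #|{: A}| ^ m * (p - #|T|) ^ D.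
Proof.
apply: leq_trans (leq_mul (card_bigcup_le _ _) (leqnn _)) _.
rewrite big_distrl /= -mulnA -sum_nat_const.
by apply: leq_sum => e Ee; rewrite card_alive.
Qed.

(** The coordinates whose conditions remain to be met by a lift of clique [j] once its edge [e] is
    known to be alive. *)
Let act (j : I) (e : {set X}) : {set C} :=
  [set c | (c.2 \in msub m (kap j) :\ e) && (c.1 \in Je c.2)].

Let card_act j e : j \in Je e -> e \in E -> #|act j e| = ('C(t, m)).-1 * D.
Proof.
case: sysE => cardE cardK subE degE; rewrite inE => /andP[Jj sub] Ee.
have <- : #|msub m (kap j) :\ e| = ('C(t, m)).-1.
  rewrite -(cardK j Jj) -card_msub (cardsD1 e (msub _ _)).
  by have -> : e \in msub m (kap j) by apply/msubP; rewrite sub cardE.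
rewrite -sum_nat_const -sum1dep_card.
rewrite (partition_big snd (mem (msub m (kap j) :\ e))) /= => [|c /andP[] //].
apply: eq_bigr => e' Ke'; rewrite -(degE e'); last first.
  by case/setD1P: Ke' => _ /(subsetP (subE j Jj)).
rewrite sum1dep_card -(card_imset _ (_ : injective (fun l => (l, e') : C))); last first.
  by move=> l l' [].
apply: eq_card => -[l e'']; rewrite !inE /=; apply/andP/imsetP.
  case=> /andP[_ Jl] /eqP eq_e; exists l; rewrite -?eq_e // inE; by case/andP: Jl => -> ->.
case=> l'; rewrite inE => Jl' [-> ->]; rewrite eqxx Jl' andbT.
by move: Ke'; rewrite !inE.
Qed.

(** The number of ways to extend an alive lift of an edge to a surviving clique over a given [j]; it
    depends on neither, and [count_avoid] makes the division exact. *)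
Let mult := (p ^ (#|{: C}| * (#|X| - m)) * (p - #|T|) ^ (('C(t, m)).-1 * D))
             %/ p ^ (('C(t, m)).-1 * D).

Let count_ext j e (x : V) : e \in E -> j \in Je e ->
  #|[set y : V | agree e y x & [forall c in act j e, hash c.2 c y \notin T]]| = mult.
Proof.
case: sysE => cardE _ _ _ Ee Jj.
have := @count_avoid X p p_pr C e x (act j e) snd T.
rewrite card_act // cardE // /mult => <- => [|c].
  by rewrite mulnK // expn_gt0 prime_gt0.
rewrite inE => /andP[/setD1P[ne_e /msubP[_ card_c]] _].
by apply: contra ne_e => sub; rewrite eqEcard sub card_c cardE //=.
Qed.

Lemma left_clique_system : exists2 D', 0 < D'
  & clique_system m t left_edges left_cliques (fun jx => graph_on (kap jx.1) jx.2) D'.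
Proof.
have [cardE cardK subE degE] := sysE.
(* Each of the [D] cliques through the edge contributes [mult] lifts. Without edges the degree is
   arbitrary, and 1 is positive. *)
exists (if E == set0 then 1 else D * mult).
  case: (set_0Vmem E) => [-> | [e Ee]]; first by rewrite eqxx.
  case: eqP => // _.
  rewrite muln_gt0 D_gt0 /=.
  have /card_gt0P[j Jj] : 0 < #|Je e| by rewrite degE.
  have := @count_avoid X p p_pr C e 0%R (act j e) snd T.
  rewrite -(count_ext 0%R Ee Jj) => card_ext.
  have : 0 < p ^ (#|{: C}| * (#|X| - #|e|)) * (p - #|T|) ^ #|act j e|.
    by rewrite muln_gt0 !expn_gt0 prime_gt0 //= subn_gt0 ltTp.
  rewrite -card_ext; first by rewrite muln_gt0 => /andP[].
  move=> c; rewrite inE => /andP[/setD1P[ne_e /msubP[_ card_c]] _].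
  by apply: contra ne_e => sub; rewrite eqEcard sub card_c cardE //=.
split=> [_ /bigcupP[e Ee /imsetP[x _ ->]] | [j x] | [j x] | s].
- by rewrite card_graph_on cardE.
- by rewrite inE => /andP[/= Jj _]; rewrite card_graph_on cardK.
- rewrite inE => /andP[/= Jj /forall_inP Kalive].
  apply/subsetP => s /msubP[/sub_graph_on[e sub ->]]; rewrite card_graph_on => card_e.
  have Ke : e \in msub m (kap j) by apply/msubP.
  apply/bigcupP; exists e; first exact: (subsetP (subE j Jj)).
  exact/imset_f/Kalive.
case/bigcupP=> e Ee /imsetP[x0 x0_alive ->].
case: eqP Ee => [-> | _ Ee]; first by rewrite inE.
rewrite -(degE e Ee) -sum_nat_const -sum1dep_card.
rewrite (partition_big fst (mem (Je e))) /= => [|[j x]]; last first.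
  by rewrite !inE /= subset_graph_on => /andP[/andP[-> _] /andP[-> _]].
apply: eq_bigr => j Jj; rewrite sum1dep_card -(count_ext x0 Ee Jj).
rewrite -(card_imset _ (_ : injective (fun y => (j, y) : I * V))); last first.
  by move=> y y' [].
move: (Jj); rewrite inE => /andP[JJj ej].
apply: eq_card => -[j' x]; rewrite !inE /=; apply/andP/imsetP => [[] | [y]].
  move=> /andP[/andP[_ /forall_inP Kalive]]; rewrite subset_graph_on => /andP[_ x0x].
  move=> /eqP eq_j; rewrite eq_j in Kalive *; exists x => //; rewrite inE agree_sym x0x.
  apply/forall_inP => -[l e'] /[!inE] /= /andP[/andP[_ Ke'] Jl].
  have := Kalive e'; rewrite !inE => /(_ Ke')/forall_inP; apply.
  by rewrite inE.
rewrite inE => /andP[yx0 /forall_inP avoid] [-> ->]; rewrite eqxx JJj /= subset_graph_on ej.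
rewrite [agree e x0 y]agree_sym yx0 /= andbT; split=> //; apply/forall_inP => e' Ke'.
have [-> | ne_e'] := eqVneq e' e; first by apply: alive_agree x0_alive; rewrite agree_sym.
rewrite inE; apply/forall_inP => l Jl; apply: (avoid (l, e')).
by rewrite !inE ne_e' /=; move: Ke' Jl; rewrite !inE => -> ->.
Qed.

(** A lift of [e] that is not alive has a hash in [T] for some clique [j], and the code of [j] for
    that value covers it. There are [#|J| * #|T|] codes of at most [#|A| ^ m / p] words, and [#|J|]
    is known by double counting. *)
Lemma nibble_blocks : exists B : {set {set X * A}},
  [/\ forall b, b \in B -> #|b| = t,
      forall e (x : V), e \in E -> graph_on e x \in left_edges \/
        exists2 b, b \in B & graph_on e x \subset b
    & #|B| * 'C(t, m) * p <= #|E| * D * #|T| * #|{: A}| ^ m].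
Proof.
have [cardE cardK subE degE] := sysE.
have code (jz : I * 'F_p) : exists W : {set V}, jz.1 \in J ->
    #|W| * p <= #|{: A}| ^ m /\
    forall (e : {set X}) y, e \subset kap jz.1 -> #|e| = m ->
      hash e (jz.1, e) y = jz.2 -> exists2 w, w \in W & agree e y w.
  case: jz => j z; case: (boolP (j \in J)) => /= [Jj | _]; last by exists set0.
  have le_t : #|kap j| <= t by rewrite cardK.
  have [W leW codeW] := hash_code p_pr lt_p m_gt0 j le_t z.
  by exists W; rewrite cardA.
have [W codeW] := fin_all_exists code.
exists (\bigcup_(jz in setX J T) [set graph_on (kap jz.1) w | w in W jz]); split.
- move=> b /bigcupP[[j z] /setXP[/= Jj _] /imsetP[w _ ->]].
  by rewrite card_graph_on cardK.
- move=> e x Ee; case: (boolP (x \in alive e)) => [x_alive | ].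
    by left; apply/bigcupP; exists e => //; apply: imset_f.
  rewrite inE negb_forall_in => /existsP[j /andP[]]; rewrite inE negbK => /andP[Jj ej] Tx.
  right; have [_ codeWj] := codeW (j, hash e (j, e) x) Jj.
  have [w Ww xw] := codeWj e x ej (cardE e Ee) erefl.
  exists (graph_on (kap j) w); last by rewrite subset_graph_on ej.
  apply/bigcupP; exists (j, hash e (j, e) x); first by apply/setXP.
  exact: imset_f.
rewrite mulnAC; apply: leq_trans (_ : #|J| * #|T| * #|{: A}| ^ m * 'C(t, m) <= _).
  rewrite leq_mul2r; apply/orP; right.
  apply: leq_trans (leq_mul (card_bigcup_le _ _) (leqnn _)) _.
  rewrite big_distrl -cardsX -sum_nat_const; apply: leq_sum => -[j z] /setXP[/= Jj _].
  have [leW _] := codeW (j, z) Jj.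
  by apply: leq_trans leW; rewrite leq_mul2r leq_imset_card orbT.
by rewrite -(clique_system_count sysE) mulnAC [_ * 'C(t, m)]mulnAC.
Qed.

End Nibble.

(** * Iterating the nibble *)

Section Coverable.

Local Open Scope ring_scope.

Variables (R : archiRealFieldType) (m t : nat).
Hypotheses (m_gt0 : (0 < m)%N) (le_mt : (m <= t)%N).

(** Here [eta] is the number of blocks per lifted edge. The array property of [A] allows blocks
    found earlier to be lifted once more when blow-ups are composed. *)
Definition coverable (X : finType) (E : {set {set X}}) (eta : R) : Prop :=
  exists A : finType, [/\ (0 < #|A|)%N, strong_array m t A
    & exists B : {set {set X * A}},
      [/\ forall b, b \in B -> (#|b| <= t)%N,
          forall e (x : {ffun X -> A}), e \in E ->
            exists2 b, b \in B & graph_on e x \subset b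
        & #|B|%:R <= eta * (#|E| * #|A| ^ m)%:R]].

Lemma coverable_le (X : finType) (E : {set {set X}}) (eta eta' : R) :
  eta <= eta' -> coverable E eta -> coverable E eta'.
Proof.
move=> le_eta [A [A_gt0 arrA [B [leB covB cardB]]]]; exists A; split=> //.
by exists B; split=> //; apply: le_trans cardB _; rewrite ler_wpM2r ?ler0n.
Qed.

Lemma coverable1 (X : finType) (E : {set {set X}}) :
  (forall e, e \in E -> #|e| = m) -> coverable E 1.
Proof.
move=> cardE; exists unit; split; first by rewrite card_unit.
  exact: strong_array_unit.
exists [set graph_on e [ffun=> tt] | e : {set X} in E]; split.
- by move=> _ /imsetP[e Ee ->]; rewrite card_graph_on cardE.
- move=> e x Ee; exists (graph_on e [ffun=> tt]); first exact: imset_f.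
  by rewrite subset_graph_on subxx; apply/agreeP => i _; rewrite ffunE; case: (x i).
by rewrite mul1r card_unit exp1n muln1 ler_nat leq_imset_card.
Qed.

(** Each block of [B1] is lifted along the at most [#|A'| ^ m] words of a strong array, which covers
    all lifts of its [m]-subsets; the lifts of [E'] are left to the second covering. *)
Lemma coverable_compose (X A : finType) (E : {set {set X}}) (E' B1 : {set {set X * A}})
    (eta1 c eta : R) :
    (0 < #|A|)%N -> strong_array m t A -> 0 <= eta ->
    (forall e, e \in E -> #|e| = m) ->
    (forall b, b \in B1 -> (#|b| <= t)%N) ->
    (forall e (x : {ffun X -> A}), e \in E -> graph_on e x \in E' \/
       exists2 b, b \in B1 & graph_on e x \subset b) ->
    #|B1|%:R <= eta1 * (#|E| * #|A| ^ m)%:R ->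
    #|E'|%:R <= c * (#|E| * #|A| ^ m)%:R ->
  coverable E' eta -> coverable E (eta1 + c * eta).
Proof.
move=> A_gt0 arrA eta_ge0 cardE leB1 covE cardB1 cardE'.
case=> A' [A'_gt0 arrA' [B' [leB' covB' cardB']]].
have code b : exists W : {set {ffun (X * A)%type -> A'}}, b \in B1 ->
    (#|W| <= #|A'| ^ m)%N /\
    forall (e : {set X * A}) y, e \subset b -> #|e| = m ->
      exists2 w, w \in W & agree e y w.
  case: (boolP (b \in B1)) => [B1b | _]; last by exists set0.
  by have [W leW codeW] := arrA' _ b (leB1 b B1b); exists W.
have [W codeW] := fin_all_exists code.
pose assoc (iaa : X * A * A') : X * (A * A') := (iaa.1.1, (iaa.1.2, iaa.2)).
have assoc_inj : injective assoc by move=> [[i a] a'] [[j b] b'] [-> -> ->].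
pose B2 := \bigcup_(b in B1) [set graph_on b w | w in W b].
exists (A * A')%type; split; first by rewrite card_prod muln_gt0 A_gt0.
  exact: strong_array_prod.
exists [set assoc @: b | b : {set X * A * A'} in B2 :|: B']; split.
- move=> _ /imsetP[b B2b ->]; rewrite card_imset //.
  case/setUP: B2b => [/bigcupP[b1 B1b1 /imsetP[w _ ->]] | /leB' //].
  by rewrite card_graph_on leB1.
- move=> e x Ee.
  pose x1 := [ffun i => (x i).1]; pose x2 := [ffun ia : X * A => (x ia.1).2].
  have ->: graph_on e x = assoc @: graph_on (graph_on e x1) x2.
    rewrite /graph_on -!imset_comp; apply: eq_imset => i /=.
    by rewrite /assoc !ffunE /=; case: (x i).
  have [b Bb sub] : exists2 b, b \in B2 :|: B' & graph_on (graph_on e x1) x2 \subset b.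
    have [E'e | [b1 B1b1 sub]] := covE e x1 Ee.
      by have [b B'b sub] := covB' _ x2 E'e; exists b; rewrite // inE B'b orbT.
    have [_ codeb] := codeW b1 B1b1.
    have [|w Ww xw] := codeb _ x2 sub; first by rewrite card_graph_on cardE.
    exists (graph_on b1 w); last by rewrite subset_graph_on sub.
    by apply/setUP; left; apply/bigcupP; exists b1 => //; apply: imset_f.
  by exists (assoc @: b); [apply: imset_f | apply: imsetS].
have leB2 : (#|B2| <= #|B1| * #|A'| ^ m)%N.
  apply: card_bigcup_leM => b B1b; apply: leq_trans (leq_imset_card _ _) _.
  by case: (codeW b B1b).
apply: le_trans (_ : (#|B1| * #|A'| ^ m)%:R + #|B'|%:R <= _).
  rewrite -natrD ler_nat; apply: leq_trans (leq_imset_card _ _) _.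
  by apply: leq_trans (leq_card_setU _ _) _; rewrite leq_add2r.
rewrite card_prod expnMn mulnA natrM [(_ * #|A'| ^ m)%:R]natrM mulrDl.
apply: lerD; first by rewrite [leRHS]mulrA ler_wpM2r ?ler0n.
apply: le_trans cardB' _; rewrite natrM.
have := ler_wpM2r (ler0n R (#|A'| ^ m)) (ler_wpM2l eta_ge0 cardE').
by lra.
Qed.

Lemma bernoulli_le (x : R) n : 0 <= x -> 1 + n%:R * x <= (1 + x) ^+ n.
Proof.
move=> x_ge0; elim: n => [|n IHn]; first by rewrite mul0r addr0 expr0.
rewrite exprS; apply: le_trans (_ : (1 + x) * (1 + n%:R * x) <= _); last first.
  by rewrite ler_wpM2l // addr_ge0.
rewrite -natr1 mulrDl; have : 0 <= x * (n%:R * x) by rewrite !mulr_ge0.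
lra.
Qed.

(** Multiply by [(1 + x) ^+ n]: the product is at most 1, and Bernoulli bounds the factor from
    below. *)
Lemma expr1B_le (x : R) n : 0 <= x <= 1 -> (1 - x) ^+ n <= (1 + n%:R * x)^-1.
Proof.
move=> /andP[x_ge0 x_le1].
have s_gt0 : 0 < 1 + n%:R * x by rewrite ltr_pwDl // mulr_ge0.
rewrite -[leRHS]mul1r ler_pdivlMr //.
apply: le_trans (_ : (1 - x) ^+ n * (1 + x) ^+ n <= _).
  by rewrite ler_wpM2l ?exprn_ge0 ?subr_ge0 // bernoulli_le.
by rewrite -exprMn exprn_ile1 //; nra.
Qed.

(* A perfect packing by [t]-sets would give the value [zeta = 0]. *)
Definition always_coverable (zeta : R) : Prop :=
  forall (X I : finType) (E : {set {set X}}) (J : {set I}) (kap : I -> {set X}) D,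
    clique_system m t E J kap D -> (0 < D)%N ->
  coverable E ((1 + zeta) / 'C(t, m)%:R).

(** With [s] between [1 / (2M)] and [1 / M], the second-order loss [s ^+ 2] of one step is absorbed
    by the term [4 / M], while the excess [xi] shrinks by a constant factor. *)
Lemma nibble_recurrence (M s c xi : R) :
    2 <= M -> 0 <= xi -> M * s <= 1 -> 1 <= 2 * (M * s) -> c <= (1 + s)^-1 ->
  s + c * (1 + (4 / M + xi)) <= 1 + (4 / M + (1 - (4 * M)^-1) * xi).
Proof.
move=> M_ge2 xi_ge0 Ms_le Ms_ge le_c.
have M_gt0 : 0 < M by lra.
have s_ge0 : 0 <= s by rewrite -(pmulr_rge0 _ M_gt0); lra.
have s_le : s <= 2^-1 by nra.
have {}le_c : c <= 1 - s + s ^+ 2.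
  by apply: le_trans le_c _; rewrite -div1r ler_pdivrMr; nra.
pose v := M^-1; have v_gt0 : 0 < v by rewrite invr_gt0.
have Mv : M * v = 1 by rewrite divff ?gt_eqF.
have -> : (4 * M)^-1 = v / 4 by rewrite invfM mulrC.
rewrite -/v.
have s_lev : s <= v by rewrite -(ler_pM2l M_gt0) Mv.
have s_gev : v / 2 <= s by rewrite -(ler_pM2l M_gt0) mulrA Mv; lra.
have w_ge0 : 0 <= 1 + (4 * v + xi) by nra.
have := ler_wpM2r w_ge0 le_c.
have : s * (s + (s - 1) * (4 * v)) <= 0 by rewrite mulr_ge0_le0 //; nra.
have : (s ^+ 2 - s + v / 4) * xi <= 0 by rewrite mulr_le0_ge0 //; nra.
by nra.
Qed.

Lemma always_coverable_step (M : nat) (xi : R) : (2 <= M)%N -> 0 <= xi ->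
    always_coverable (4 / M%:R + xi) ->
  always_coverable (4 / M%:R + (1 - (4 * M%:R)^-1) * xi).
Proof.
move=> M_ge2 xi_ge0 cov X I E J kap D sysE D_gt0.
have MD_gt0 : (0 < M * D)%N by rewrite muln_gt0 D_gt0 andbT; lia.
(* The codes need [p] above ['C(t, m)]; above [M * D], the integer [a] is positive, and rounding
   down loses less than a factor 2 in [s]. *)
have [p lt_p p_pr] := prime_above (maxn 'C(t, m) (M * D)).
have lt_Cp : ('C(t, m) < p)%N by apply: leq_ltn_trans lt_p; rewrite leq_maxl.
have lt_MDp : (M * D < p)%N by apply: leq_ltn_trans lt_p; rewrite leq_maxr.
pose a := (p %/ (M * D))%N.
have a_gt0 : (0 < a)%N by rewrite divn_gt0 // ltnW.
have le_a : (a * (M * D) <= p)%N by apply: leq_trunc_div.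
have ge_a : (p < 2 * a * (M * D))%N.
  apply: leq_trans (ltn_ceil p MD_gt0) _; rewrite leq_mul2r; apply/orP; right.
  by rewrite -/a; lia.
have lt_ap : (a < p)%N by apply: leq_trans le_a; rewrite ltn_Pmulr //; nia.
have [T /eqP cardT] : exists T : {set 'F_p}, #|T| == a.
  have : (0 < #|[set T : {set 'F_p} | T \subset setT & #|T| == a]|)%N.
    by rewrite cards_draws cardsT card_Fp // bin_gt0 ltnW.
  by case/card_gt0P=> T; rewrite inE => /andP[_]; exists T.
have ltTp : (#|T| < p)%N by rewrite cardT.
have [D' D'_gt0 sysE'] := left_clique_system p_pr ltTp sysE D_gt0.
have [B [leB covB cardB]] := nibble_blocks T p_pr lt_Cp m_gt0 sysE.
have cardE' := card_left_edges T p_pr m_gt0 sysE.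
have [cardE _ _ _] := sysE.
have k_gt0 : 0 < 'C(t, m)%:R :> R by rewrite ltr0n bin_gt0.
have p_gt0 : 0 < p%:R :> R by rewrite ltr0n prime_gt0.
pose g : R := a%:R / p%:R; pose s : R := D%:R * g.
have arrA := @strong_array_Fp m t p p_pr lt_Cp (I * {set X})%type.
have A_gt0 : (0 < #|{: {ffun I * {set X} -> 'F_p}}|)%N.
  by rewrite card_ffun expn_gt0 card_Fp // prime_gt0.
have M_gt0 : 0 < M%:R :> R by rewrite ltr0n ltnW.
have M_ge2R : 2 <= M%:R :> R by rewrite ler_nat.
have zeta_ge0 : 0 <= 4 / M%:R + xi by rewrite addr_ge0 // divr_ge0 // ler0n.
have ms_le : M%:R * s <= 1.
  rewrite /s /g mulrA mulrA -!natrM ler_pdivrMr // mul1r ler_nat.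
  by apply: leq_trans le_a; apply: eq_leq; ring.
have ms_ge : 1 <= 2 * (M%:R * s).
  rewrite /s /g !mulrA -!natrM ler_pdivlMr // mul1r ler_nat ltnW //.
  by apply: leq_trans ge_a _; apply: eq_leq; ring.
have g01 : 0 <= g <= 1.
  by rewrite divr_ge0 ?ler0n //= ler_pdivrMr // mul1r ler_nat ltnW.
have expg := expr1B_le D g01; rewrite -/s in expg.
apply: coverable_le (coverable_compose (eta1 := s / 'C(t, m)%:R) (c := (1 - g) ^+ D)
  A_gt0 arrA _ cardE _ covB _ _ (cov _ _ _ _ _ _ sysE' D'_gt0)).
- rewrite mulrA -mulrDl ler_wpM2r ?invr_ge0 ?(ltW k_gt0) //.
  exact: nibble_recurrence.
- by rewrite divr_ge0 ?(ltW k_gt0) // addr_ge0.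
- by move=> b /leB ->; rewrite leqnn.
- rewrite mulrAC ler_pdivlMr // /s /g mulrA mulrAC ler_pdivlMr // -!natrM ler_nat.
  by apply: leq_trans cardB _; rewrite cardT; apply: eq_leq; ring.
have -> : 1 - g = (p - a)%:R / p%:R.
  by rewrite natrB ?(ltnW lt_ap) // mulrBl divff ?gt_eqF.
rewrite expr_div_n mulrAC ler_pdivlMr ?exprn_gt0 // -!natrX -!natrM ler_nat.
by rewrite [leqRHS]mulnC -cardT.
Qed.

Lemma always_coverableP (zeta : R) : 0 < zeta -> always_coverable zeta.
Proof.
move=> zeta_gt0; pose k : R := 'C(t, m)%:R.
have k_ge1 : 1 <= k by rewrite ler1n bin_gt0.
have [M [M_ge2 M_zeta]] : exists M : nat, (2 <= M)%N /\ 8 <= zeta * M%:R.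
  exists (Num.bound (8 / zeta)).+2; split=> //.
  have : 8 / zeta < (Num.bound (8 / zeta))%:R by rewrite archi_boundP // divr_ge0 // ltW.
  by rewrite ltr_pdivrMr // -!natr1 => ?; nra.
have M_gt0 : 0 < M%:R :> R by rewrite ltr0n ltnW.
pose q : R := 1 - (4 * M%:R)^-1.
have q_ge0 : 0 <= q.
  rewrite subr_ge0 invf_le1; last by rewrite mulr_gt0.
  by have : 2 <= M%:R :> R by [rewrite ler_nat]; lra.
(* The start is the covering by single edges, whose cost 1 is at most [(1 + 4 / M + k) / k]. *)
have iter n : always_coverable (4 / M%:R + q ^+ n * k).
  elim: n => [|n IHn].
    move=> X I E J kap D sysE _; apply: coverable_le (coverable1 _); last first.
      by case: sysE.
    rewrite expr0 mul1r ler_pdivlMr ?(lt_le_trans ltr01) // -/k.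
    by have : 0 <= 4 / M%:R :> R by [rewrite divr_ge0 // ltW]; lra.
  rewrite exprS -mulrA; apply: always_coverable_step => //.
  by rewrite mulr_ge0 ?exprn_ge0 // (le_trans ler01).
have [n small] : exists n, q ^+ n * k <= zeta / 2.
  exists (Num.bound (8 * M%:R * k / zeta)).
  set n := Num.bound _; set x := (4 * M%:R)^-1 in q q_ge0 iter *.
  have x_gt0 : 0 < x by rewrite invr_gt0 mulr_gt0.
  have : 8 * M%:R * k / zeta < n%:R.
    by rewrite archi_boundP // divr_ge0 ?(ltW zeta_gt0) // !mulr_ge0 // (le_trans ler01).
  rewrite ltr_pdivrMr // => lt_n.
  have x01 : 0 <= x <= 1 by rewrite ltW //= -subr_ge0.
  have nx_gt0 : 0 < 1 + n%:R * x by rewrite ltr_pwDl // mulr_ge0 // ltW.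
  apply: le_trans (ler_wpM2r _ (expr1B_le n x01)) _; first exact: le_trans ler01 _.
  rewrite mulrC ler_pdivrMr //.
  have Mx : M%:R * x = 4^-1 by rewrite /x invfM mulrCA divff ?mulr1 ?gt_eqF.
  have : 2 * k <= n%:R * x * zeta.
    have := ler_wpM2r (ltW x_gt0) (ltW lt_n).
    have -> : 8 * M%:R * k * x = 8 * k * (M%:R * x) by ring.
    by rewrite Mx; lra.
  by lra.
move=> X I E J kap D sysE D_gt0.
apply: coverable_le (iter n _ _ _ _ _ _ sysE D_gt0).
rewrite ler_wpM2r ?invr_ge0 ?(le_trans ler01) // lerD2l.
have : 4 / M%:R <= zeta / 2 by rewrite ler_pdivrMr //; lra.
by lra.
Qed.

End Coverable.

(** * Asymptotically optimal coverings *)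

Definition covering (m t : nat) (X : finType) (B : {set {set X}}) : Prop :=
  (forall b, b \in B -> #|b| <= t) /\
  (forall e : {set X}, #|e| = m -> exists2 b, b \in B & e \subset b).

Definition cover_deg (X : finType) (B : {set {set X}}) (v : X) : nat :=
  #|[set b in B | v \in b]|.

(** * Restriction of coverings along injections *)

Section Preim.

Variables (m t : nat) (X Y : finType) (f : X -> Y).
Hypothesis f_inj : injective f.
Variable B : {set {set Y}}.

Definition preim_cover : {set {set X}} := [set f @^-1: b | b : {set Y} in B].

Lemma covering_preim : covering m t B -> covering m t preim_cover.
Proof.
move=> [leB covB]; split=> [_ /imsetP[b Bb ->] | e card_e].
  apply: leq_trans (leB b Bb); rewrite -(card_imset _ f_inj).
  by apply/subset_leq_card/subsetP => _ /imsetP[x bx ->]; rewrite inE in bx.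
have [|b Bb sub] := covB (f @: e); first by rewrite card_imset.
by exists (f @^-1: b); [apply: imset_f | rewrite -sub_imset_pre].
Qed.

Lemma cover_deg_preim v : cover_deg preim_cover v <= cover_deg B (f v).
Proof.
apply: leq_trans (leq_imset_card (fun b : {set Y} => f @^-1: b) _).
apply/subset_leq_card/subsetP => b'; rewrite inE => /andP[/imsetP[b Bb ->]].
by rewrite inE => bv; apply: imset_f; rewrite inE Bb.
Qed.

End Preim.

Lemma leq_bin_exp n k : 'C(n, k) * k`! <= n ^ k.
Proof.
rewrite bin_ffact; elim: k => [|k IHk]; first by rewrite ffactn0.
by rewrite ffactnSr expnSr leq_mul // leq_subr.
Qed.

Lemma geq_bin_exp n k : (n - k) ^ k <= 'C(n, k) * k`!.
Proof.
rewrite bin_ffact; elim: k => [|k IHk]; first by rewrite ffactn0.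
rewrite ffactnSr expnSr leq_mul ?leq_sub2l //.
by apply: leq_trans IHk; case: (k) => // j; rewrite leq_exp2r // leq_sub2l.
Qed.

(** Division-free bound showing that almost all [j]-sets of a blow-up are transversal: [i = 0]
    serves the total count and [i = 1] the degrees. *)
Lemma bin_blowup n a i j :
  'C(n * a - i, j) * (n - i - j) ^ j <= 'C(n - i, j) * a ^ j * n ^ j.
Proof.
rewrite -(@leq_pmul2r j`!) ?fact_gt0 //.
apply: leq_trans (_ : (n * a) ^ j * (n - i - j) ^ j <= _).
  rewrite mulnAC leq_mul2r; apply/orP; right.
  apply: leq_trans (leq_bin_exp _ _) _.
  by case: j => [|j] //; rewrite leq_exp2r // leq_subr.
have -> : 'C(n - i, j) * a ^ j * n ^ j * j`! = 'C(n - i, j) * j`! * (n * a) ^ j.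
  by rewrite expnMn; ring.
by rewrite mulnC leq_mul2r geq_bin_exp orbT.
Qed.

Lemma subset_setC1 (X : finType) (s : {set X}) v : (s \subset [set~ v]) = (v \notin s).
Proof. by rewrite subsetC sub1set inE. Qed.

(** * Transversal and non-transversal sets of a blow-up *)

Section Transversals.

Variables (m : nat) (X A : finType).
Hypothesis A_gt0 : 0 < #|A|.

Definition transversals k (S : {set X}) : {set {set X * A}} :=
  \bigcup_(e in msub k S) [set graph_on e x | x in [set: {ffun X -> A}]].

Lemma transversalsP k (S : {set X}) (s : {set X * A}) :
  reflect (exists (e : {set X}) x, [/\ e \subset S, #|e| = k & s = graph_on e x])
          (s \in transversals k S).
Proof.
apply: (iffP bigcupP) => [[e /msubP[sub card_e] /imsetP[x _ ->]] | [e [x [sub card_e ->]]]].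
  by exists e, x.
by exists e; [apply/msubP | apply: imset_f; rewrite inE].
Qed.

Lemma card_transversals k (S : {set X}) :
  #|transversals k S| = 'C(#|S|, k) * #|A| ^ k.
Proof. by rewrite (@card_graphs_on _ _ _ k) // => [|e /msubP[]//]; rewrite card_msub. Qed.

Definition nontransversals : {set {set X * A}} :=
  [set s : {set X * A} | #|s| == m] :\: transversals m setT.

Lemma card_nontransversals :
  #|nontransversals| = 'C(#|X| * #|A|, m) - 'C(#|X|, m) * #|A| ^ m.
Proof.
rewrite cardsD; congr (_ - _); first by rewrite card_draws card_prod.
rewrite -[#|X|]cardsT -card_transversals; congr #|pred_of_set _|.
apply/setIidPr/subsetP => s /transversalsP[e [x [_ card_e ->]]].
by rewrite inE card_graph_on card_e.
Qed.

(** The transversals through [v] arise uniquely by adding [v] to a transversal [(m - 1)]-set away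
    from [v.1]; they are subtracted from all [m]-sets through [v]. *)
Lemma nontransversals_deg (v : X * A) : 0 < m ->
  cover_deg nontransversals v
    <= 'C(#|X| * #|A| - 1, m - 1) - 'C(#|X| - 1, m - 1) * #|A| ^ (m - 1).
Proof.
move=> m_gt0; pose withv := [set s : {set X * A} | #|s| == m & v \in s].
pose addv := [set v |: s | s in transversals (m - 1) [set~ v.1]].
have card_addv : #|addv| = 'C(#|X| - 1, m - 1) * #|A| ^ (m - 1).
  rewrite card_in_imset ?card_transversals ?cardsC1 ?subn1 // => s s'.
  move=> /transversalsP[e [x [sub _ ->]]] /transversalsP[e' [x' [sub' _ ->]]] eq_s.
  have nv (d : {set X}) y : d \subset [set~ v.1] -> v \notin graph_on d y.
    by move=> /subsetP subd; rewrite in_graph_on; apply/negP => /andP[/subd]; rewrite !inE eqxx.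
  by rewrite -(setU1K (nv _ x sub)) eq_s setU1K ?nv.
have card_withv : #|withv| = 'C(#|X| * #|A| - 1, m - 1).
  rewrite -card_prod subn1 -(cardsC1 v) -cards_draws.
  rewrite -(card_in_imset (_ : {in [set s : {set X * A} | s \subset [set~ v] & #|s| == m - 1] &,
    injective (setU [set v])})); last first.
    move=> s s'; rewrite !inE !subset_setC1 => /andP[nv _] /andP[nv' _] eq_s.
    by rewrite -(setU1K nv) eq_s setU1K.
  apply: eq_card => s; rewrite inE; apply/andP/imsetP => [[/eqP card_s sv] | [s' + ->]].
    exists (s :\ v); last by rewrite setD1K.
    by rewrite inE subset_setC1 setD11 /=; rewrite -card_s (cardsD1 v s) sv addKn.
  by rewrite inE subset_setC1 => /andP[nv /eqP card_s']; rewrite cardsU1 nv card_s' setU11 subnKC.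
have sub_addv : addv \subset withv.
  apply/subsetP => _ /imsetP[s /transversalsP[e [x [/subsetP sub card_e ->]]] ->].
  rewrite inE setU11 andbT cardsU1 card_graph_on card_e.
  have -> : v \notin graph_on e x.
    by rewrite in_graph_on; apply/negP => /andP[/sub]; rewrite !inE eqxx.
  by rewrite subnKC.
rewrite -card_addv -card_withv -(setIidPr sub_addv) -cardsD.
apply/subset_leq_card/subsetP => s; rewrite !inE => /andP[/andP[ntr card_s] sv].
rewrite sv card_s !andbT; apply: contra ntr.
case/imsetP=> s' /transversalsP[e [x [/subsetP sub card_e ->]]] ->.
apply/transversalsP; exists (v.1 |: e), [ffun i => if i == v.1 then v.2 else x i].
split; first exact: subsetT.
  by rewrite cardsU1 card_e; case: (boolP (v.1 \in e)) => [/sub|_]; rewrite ?inE ?eqxx ?subnKC.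
apply/setP => -[i a]; rewrite !inE !in_graph_on !inE ffunE /=.
case: v {withv addv card_addv card_withv sub_addv sv} sub => j b /= sub.
rewrite xpair_eqE; case: eqP => [-> | _] //=.
by case: (boolP (j \in e)) => [/sub|_]; rewrite ?inE ?eqxx //= orbF.
Qed.

End Transversals.

(** Ensures that the truncated differences counting non-transversals are true differences. *)
Lemma leq_bin_blowup n a i j : 0 < a -> 'C(n - i, j) * a ^ j <= 'C(n * a - i, j).
Proof.
move=> a_gt0; rewrite -(@leq_pmul2r j`!) ?fact_gt0 // mulnAC !bin_ffact.
elim: j => [|j IHj]; first by rewrite !ffactn0 expn0.
rewrite !ffactnSr expnSr mulnACA leq_mul // -!subnDA mulnBl leq_sub2l //.
by rewrite leq_pmulr.
Qed.

(** Complementation matches the [t]-sets containing [e] with the [(n - t)]-subsets of the complement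
    of [e]. *)
Lemma complete_clique_system n m t : m <= t <= n ->
  clique_system m t (msub m [set: 'I_n]) [set K : {set 'I_n} | #|K| == t] id
    'C(n - m, n - t).
Proof.
move=> /andP[le_mt le_tn]; split=> [e /msubP[] // | K | K _ | e /msubP[_ card_e]].
- by rewrite inE => /eqP.
- by apply/subsetP => e /msubP[_ card_e]; apply/msubP; rewrite subsetT.
have card_ec : #|~: e| = n - m by rewrite cardsCs setCK card_ord card_e.
rewrite -card_ec -cards_draws -(card_imset _ (@setC_inj _)).
apply: eq_card => K; rewrite -[K]setCK (mem_imset _ _ (@setC_inj _)) !inE setCS setCK.
rewrite andbC; congr (_ && _); have := cardsC K; rewrite card_ord => card_K.
by apply/eqP/eqP; lia.
Qed.

(** * Coverings of nearly optimal size *)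

Section Rodl.

Local Open Scope ring_scope.

Variable R : archiRealFieldType.

Lemma expr1B_ge (x : R) n : 0 <= x <= 1 -> 1 - n%:R * x <= (1 - x) ^+ n.
Proof.
move=> /andP[x_ge0 x_le1]; elim: n => [|n IHn]; first by rewrite mul0r subr0 expr0.
rewrite exprS; apply: le_trans (_ : (1 - x) * (1 - n%:R * x) <= _); last first.
  by rewrite ler_wpM2l // subr_ge0.
rewrite -natr1 mulrDl; have : 0 <= x * (n%:R * x) by rewrite !mulr_ge0.
lra.
Qed.

Lemma bin_blowup_ratio n a i j : (0 < n)%N -> (i + j <= n)%N ->
  ('C(n * a - i, j))%:R * (1 - (j * (i + j))%:R / n%:R) <= ('C(n - i, j) * a ^ j)%:R :> R.
Proof.
move=> n_gt0 le_n; have n_gt0R : 0 < n%:R :> R by rewrite ltr0n.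
pose x : R := (i + j)%:R / n%:R.
have x01 : 0 <= x <= 1.
  by rewrite divr_ge0 ?ler0n //= ler_pdivrMr // mul1r ler_nat.
have -> : (j * (i + j))%:R / n%:R = j%:R * x by rewrite natrM mulrA.
apply: le_trans (ler_wpM2l (ler0n _ _) (expr1B_ge j x01)) _.
have -> : 1 - x = (n - i - j)%:R / n%:R.
  by rewrite -subnDA natrB // mulrBl divff ?gt_eqF.
rewrite expr_div_n mulrA ler_pdivrMr ?exprn_gt0 // -!natrX -!natrM ler_nat.
exact: bin_blowup.
Qed.

Variables (m t : nat).
Hypotheses (m_gt0 : (0 < m)%N) (le_mt : (m <= t)%N).

(** The complete system on [n] points is blown up by [A]: the lifts of its edges are the transversal
    [m]-sets, and the rest become blocks themselves. Each of the two costs gets half of [eps]. *)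
Theorem approximate_covering (eps : R) (N0 : nat) : 0 < eps ->
  exists N, (N0 <= N)%N /\ exists B : {set {set 'I_N}}, covering m t B /\
    #|B|%:R * 'C(t, m)%:R <= (1 + eps) * 'C(N, m)%:R.
Proof.
move=> eps_gt0; pose k : R := 'C(t, m)%:R.
have k_gt0 : 0 < k by rewrite ltr0n bin_gt0.
pose zeta := eps / 2; have zeta_gt0 : 0 < zeta by rewrite divr_gt0.
(* Non-transversals are a proportion at most [m * m / n]; this [n] keeps it below [zeta] even when
   multiplied by [k]. *)
pose n := (Num.bound ((m * m)%:R * k / zeta) + N0 + t)%N.
have n_big : (m * m)%:R * k <= zeta * n%:R.
  have : (m * m)%:R * k / zeta < (Num.bound ((m * m)%:R * k / zeta))%:R.
    by rewrite archi_boundP // divr_ge0 ?(ltW zeta_gt0) // mulr_ge0 // ltW.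
  rewrite ltr_pdivrMr // => /ltW/le_trans; apply.
  by rewrite mulrC ler_wpM2l ?(ltW zeta_gt0) // ler_nat /n -addnA leq_addr.
have le_tn : (t <= n)%N by rewrite leq_addl.
have le_mn := leq_trans le_mt le_tn.
have n_gt0 : (0 < n)%N by apply: leq_trans le_mn.
have := @always_coverableP R m t m_gt0 le_mt zeta zeta_gt0 _ _ _ _ _ _
  (@complete_clique_system n m t _) _.
rewrite le_mt le_tn bin_gt0 leq_sub2l // => /(_ isT isT).
case=> A [A_gt0 _ [B [leB covB cardB]]].
exists #|{: 'I_n * A}|; split.
  rewrite card_prod card_ord; apply: leq_trans (leq_pmulr _ A_gt0).
  by rewrite /n addnAC leq_addl.
pose B' := B :|: nontransversals m 'I_n A.
pose ev : 'I_#|{: 'I_n * A}| -> 'I_n * A := enum_val.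
exists (preim_cover ev B'); split.
  apply: covering_preim; first exact: enum_val_inj.
  split=> [b | s card_s].
    case/setUP => [/leB // |]; rewrite inE => /andP[_].
    by rewrite inE => /eqP->.
  case: (boolP (s \in transversals A m [set: 'I_n])) => [|ntr]; last first.
    by exists s => //; rewrite /B' !inE ntr card_s eqxx orbT.
  case/transversalsP=> e [x [_ card_e ->]].
  have [|b Bb sub] := covB e x; first by apply/msubP; rewrite subsetT.
  by exists b => //; rewrite inE Bb.
pose P := ('C(n, m) * #|A| ^ m)%N; pose Q := 'C(n * #|A|, m).
have card_msubT : #|msub m [set: 'I_n]| = 'C(n, m) by rewrite card_msub cardsT card_ord.
rewrite card_msubT -/P in cardB.
have cardB' : #|preim_cover ev B'|%:R <= #|B|%:R + (Q%:R - P%:R) :> R.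
  have leP : (P <= Q)%N by have := leq_bin_blowup n 0 m A_gt0; rewrite !subn0.
  rewrite -natrB // -natrD ler_nat; apply: leq_trans (leq_imset_card _ _) _.
  apply: leq_trans (leq_card_setU _ _) _; rewrite leq_add2l.
  by rewrite card_nontransversals // card_ord.
have cardQ : 'C(#|{: 'I_n * A}|, m) = Q by rewrite card_prod card_ord.
rewrite cardQ {cardQ}.
have leP : Q%:R - P%:R <= Q%:R * ((m * m)%:R / n%:R) :> R.
  have := @bin_blowup_ratio n #|A| 0 m n_gt0; rewrite !subn0 add0n => /(_ le_mn).
  rewrite -/P -/Q mulrBr mulr1; lra.
have leQ : k * (Q%:R - P%:R) <= zeta * Q%:R.
  apply: le_trans (ler_wpM2l (ltW k_gt0) leP) _.
  rewrite mulrCA [leRHS]mulrC ler_wpM2l ?ler0n // mulrA ler_pdivrMr ?ltr0n //.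
  by rewrite [k * _]mulrC.
have cardBk : #|B|%:R * k <= (1 + zeta) * P%:R.
  by move: cardB; rewrite -/k mulrAC ler_pdivlMr.
have lePQ : P%:R <= Q%:R :> R.
  by rewrite ler_nat; have := leq_bin_blowup n 0 m A_gt0; rewrite !subn0.
have zP : zeta * P%:R <= zeta * Q%:R by rewrite ler_wpM2l // ltW.
have := ler_wpM2r (ltW k_gt0) cardB'; rewrite -/k.
have -> : eps = zeta + zeta by rewrite /zeta; lra.
by lra.
Qed.

End Rodl.

(** * Balanced coverings of all large sets *)

Section Interpolation.

Local Open Scope ring_scope.

Variables (q n : nat).
Hypotheses (q_gt1 : (1 < q)%N) (co_q : coprime q n`!).

Lemma unit_sub_Zp (i j : nat) : (i <= n)%N -> (j <= n)%N -> i != j ->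
  (i%:R - j%:R : 'Z_q) \is a GRing.unit.
Proof.
wlog lt_ji : i j / (j < i)%N => [IH le_i le_j ne_ij | le_in _ _].
  have [lt_ji | lt_ij | eq_ij] := ltngtP j i; first exact: IH.
    by rewrite -opprB unitrN IH // eq_sym.
  by rewrite eq_ij eqxx in ne_ij.
rewrite -natrB ?(ltnW lt_ji) // unitZpE //.
apply: coprime_dvdr co_q; apply: dvdn_fact.
by rewrite subn_gt0 lt_ji (leq_trans (leq_subr _ _)).
Qed.

(** Newton interpolation works over the ring ['Z_q] because differences of distinct nodes are
    units. *)
Lemma interpolation (e : {set 'I_n.+1}) (y : 'I_n.+1 -> 'Z_q) :
  exists2 P : {poly 'Z_q}, (size P <= #|e|)%N & forall i, i \in e -> P.[i%:R] = y i.
Proof.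
move: {2}#|e| (erefl #|e|) => k; elim: k e => [|k IHk] e card_e.
  by exists 0 => [|i]; [rewrite size_poly0 | rewrite (cards0_eq card_e) inE].
have [i ei] : exists i, i \in e by apply/card_gt0P; rewrite card_e.
have card_ei : #|e :\ i| = k by move: card_e; rewrite (cardsD1 i) ei => -[].
have [P sizeP Py] := IHk _ card_ei.
pose Q : {poly 'Z_q} := \prod_(j <- enum (e :\ i)) ('X - (j%:R)%:P).
have sizeQ : size Q = k.+1 by rewrite size_prod_XsubC -cardE card_ei.
have hornerQ (x : 'Z_q) : Q.[x] = \prod_(j <- enum (e :\ i)) (x - j%:R).
  by rewrite horner_prod; apply: eq_bigr => j _; rewrite hornerXsubC.
have unitQ : Q.[i%:R] \is a GRing.unit.
  rewrite hornerQ big_enum /= rpred_prod // => j /setD1P[ne_ji _].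
  by rewrite unit_sub_Zp // 1?eq_sym // -ltnS ltn_ord.
exists (P + ((y i - P.[i%:R]) / Q.[i%:R])%:P * Q).
  rewrite card_e; apply: leq_trans (size_polyD _ _) _; rewrite geq_max.
  rewrite (leq_trans sizeP) ?card_ei //=.
  apply: leq_trans (size_polyMleq _ _) _; rewrite sizeQ addnS /=.
  by rewrite -[leqRHS]add1n leq_add2r size_polyC leq_b1.
move=> j ej; rewrite hornerD hornerM hornerC.
have [-> | ne_ji] := eqVneq j i; first by rewrite divrK // addrC subrK.
have -> : Q.[j%:R] = 0.
  by rewrite hornerQ big_enum /= (bigD1 j) ?in_setD1 ?ne_ji //= subrr; apply: mul0r.
by rewrite mulr0 addr0 Py // !inE ne_ji.
Qed.

End Interpolation.

Section Transport.

Variables (m' t q n : nat).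
Local Notation m := m'.+2.
Hypotheses (le_mt : m <= t) (q_gt1 : 1 < q) (co_q : coprime q n`!).
Variable B : {set {set 'I_n.+1}}.
Hypothesis covB : covering m t B.

Local Notation N := n.+1.
Local Notation coefs := {ffun 'I_m -> 'Z_q}.

Definition curve (c : coefs) : {ffun 'I_N -> 'Z_q} :=
  [ffun i : 'I_N => \sum_(j < m) c j * i%:R ^+ j]%R.

(* Through a given point, the linear coefficients of the curves are equidistributed;
   rotating [B] by this coefficient therefore averages the degrees of [B]. *)
Definition shift (c : coefs) : 'I_N := inZp (c (lift ord0 ord0)).

Definition shifted (c : coefs) (b : {set 'I_N}) : {set 'I_N} :=
  [set i | (i - shift c)%R \in b].

Definition transported : {set {set 'I_N * 'Z_q}} :=
  [set graph_on (shifted cb.1 cb.2) (curve cb.1) | cb in setX [set: coefs] B]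
    :|: nontransversals m 'I_N 'Z_q.

Lemma card_shifted c b : #|shifted c b| = #|b|.
Proof.
rewrite -(card_imset b (addIr (shift c))); apply: eq_card => i.
rewrite inE; apply/idP/imsetP => [bi | [j bj ->]]; last by rewrite addrK.
by exists (i - shift c)%R; rewrite ?subrK.
Qed.

(** A curve is interpolated through the points of a transversal, and a block of [B] is taken around
    its projection rotated back. *)
Lemma covering_transported : covering m t transported.
Proof.
have [leB coverB] := covB.
have Zq_gt0 : 0 < #|'Z_q| by rewrite card_ord.
split=> [s | s card_s].
  case/setUP=> [/imsetP[[c b] /setXP[/= _ Bb] ->] | ].
    by rewrite card_graph_on card_shifted leB.
  by rewrite inE => /andP[_]; rewrite inE => /eqP->.
case: (boolP (s \in transversals 'Z_q m [set: 'I_N])) => [|ntr]; last first.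
  by exists s => //; rewrite /transported !inE ntr card_s eqxx orbT.
case/transversalsP=> e [x [_ card_e ->]].
have [P sizeP Px] := interpolation q_gt1 co_q e x.
pose c : coefs := [ffun j : 'I_m => P`_j]%R.
have curveE i : i \in e -> curve c i = x i.
  move=> ei; rewrite -(Px i ei) ffunE (@horner_coef_wide _ m) -?card_e //.
  by apply: eq_bigr => j _; rewrite ffunE.
have [|b Bb sub] := coverB [set (i - shift c)%R | i in e].
  by rewrite card_imset //; apply: addIr.
exists (graph_on (shifted c b) (curve c)).
  by apply/setUP; left; apply/imsetP; exists (c, b) => //; apply/setXP; rewrite inE.
rewrite subset_graph_on; apply/andP; split; last by apply/agreeP => i /curveE.
by apply/subsetP => i ei; rewrite inE; apply: (subsetP sub); apply/imsetP; exists i.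
Qed.

Lemma sum_cover_deg : \sum_(j : 'I_N) cover_deg B j <= t * #|B|.
Proof.
under eq_bigr do rewrite /cover_deg -sum1dep_card big_mkcondr.
rewrite exchange_big /= mulnC -sum_nat_const; apply: leq_sum => b Bb.
by rewrite -big_mkcond /= sum1_card; case: covB => leB _; apply: leB.
Qed.

Lemma card_residues (j : 'I_N) : #|[set z : 'Z_q | inZp z == j]| <= (q %/ N).+1.
Proof.
rewrite -[leqRHS]card_ord.
have lt_div (z : 'Z_q) : z %/ N < (q %/ N).+1.
  by rewrite ltnS leq_div2r // -[leqRHS](Zp_cast q_gt1) ltnW.
rewrite -(@card_in_imset _ _ (fun z => Ordinal (lt_div z))) ?max_card //.
move=> z z'; rewrite !inE => /eqP zj /eqP z'j [] eq_div.
apply: val_inj; rewrite /= (divn_eq z N) (divn_eq z' N) eq_div; congr (_ + _).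
by have := congr1 val (etrans zj (esym z'j)).
Qed.

(** The [m'] coefficients of degree at least 2 are free; together with [z] and the value at [v.1]
    they determine the constant one. *)
Lemma card_curves_through (v : 'I_N * 'Z_q) (z : 'Z_q) :
  #|[set c : coefs | (curve c v.1 == v.2) && (c (lift ord0 ord0) == z)]| <= q ^ m'.
Proof.
pose tail (c : coefs) : {ffun 'I_m' -> 'Z_q} := [ffun j => c (lift ord0 (lift ord0 j))].
have -> : q ^ m' = #|{ffun 'I_m' -> 'Z_q}|.
  by rewrite card_ffun !card_ord Zp_cast.
rewrite -(@card_in_imset _ _ tail) ?max_card //.
move=> c c'; rewrite !inE => /andP[/eqP cv /eqP cz] /andP[/eqP c'v /eqP c'z] eq_tail.
have eq_tl j : c (lift ord0 (lift ord0 j)) = c' (lift ord0 (lift ord0 j)).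
  by have := congr1 (fun f : {ffun _ -> _} => f j) eq_tail; rewrite !ffunE.
have eq0 : c ord0 = c' ord0.
  move: cv; rewrite -c'v !ffunE !big_ord_recl cz c'z.
  under eq_bigr do rewrite eq_tl.
  by move/addIr; rewrite !expr0 !mulr1.
apply/ffunP => j; case: (unliftP ord0 j) => [j' ->|-> //].
by case: (unliftP ord0 j') => [j'' ->|->]; [apply: eq_tl | rewrite cz c'z].
Qed.

(** Curves through [v] are grouped by linear coefficient and then by its residue modulo [N]; every
    point of [B] is met about equally often, so only the sum of the degrees of [B] enters. *)
Lemma transported_deg (v : 'I_N * 'Z_q) :
  cover_deg transported v <=
    (q %/ N).+1 * q ^ m' * (t * #|B|)
    + ('C(N * q - 1, m - 1) - 'C(N - 1, m - 1) * q ^ (m - 1)).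
Proof.
have cardZq : #|'Z_q| = q by rewrite card_ord Zp_cast.
pose B1 := [set graph_on (shifted cb.1 cb.2) (curve cb.1) | cb in setX [set: coefs] B].
apply: leq_trans (_ : cover_deg B1 v + cover_deg (nontransversals m 'I_N 'Z_q) v <= _).
  rewrite /cover_deg; apply: leq_trans (leq_card_setU _ _).
  by apply/subset_leq_card/subsetP => s; rewrite !inE -andb_orl.
apply: leq_add; last first.
  have := @nontransversals_deg m 'I_N 'Z_q _ v isT; rewrite cardZq card_ord; apply.
  exact: ltnW.
pose d := cover_deg B.
apply: leq_trans (_ : \sum_(c : coefs | curve c v.1 == v.2) d (v.1 - shift c)%R <= _).
  pose inc (c : coefs) := [set b in B | (v.1 - shift c)%R \in b].
  apply: leq_trans (_ : #|[set cb : coefs * {set 'I_N} |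
      (curve cb.1 v.1 == v.2) && (cb.2 \in inc cb.1)]| <= _).
    apply: leq_trans (leq_imset_card (fun cb => graph_on (shifted cb.1 cb.2) (curve cb.1)) _).
    apply/subset_leq_card/subsetP => s; rewrite inE => /andP[/imsetP[[c b] /setXP[_ /= Bb] ->]].
    rewrite in_graph_on inE => /andP[bv /eqP vc]; apply/imsetP; exists (c, b) => //.
    by rewrite !inE /= -vc eqxx Bb.
  rewrite -sum1dep_card -(pair_big_dep (fun c => curve c v.1 == v.2) (fun c b => b \in inc c)
    (fun _ _ => 1)) /=.
  by apply: leq_sum => c _; rewrite sum1_card.
rewrite (partition_big (fun c : coefs => c (lift ord0 ord0)) predT) //=.
apply: leq_trans (_ : \sum_(z : 'Z_q) q ^ m' * d (v.1 - inZp z)%R <= _).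
  apply: leq_sum => z _.
  rewrite (eq_bigr (fun=> d (v.1 - inZp z)%R)) => [|c /andP[_ /eqP <-] //].
  by rewrite sum_nat_const leq_mul2r; apply/orP; right; rewrite -cardsE card_curves_through.
rewrite -big_distrr /= [_ * q ^ _]mulnC -mulnA leq_mul2l; apply/orP; right.
rewrite (partition_big (fun z : 'Z_q => v.1 - inZp z)%R predT) //=.
apply: leq_trans (_ : \sum_(j : 'I_N) (q %/ N).+1 * d j <= _).
  apply: leq_sum => j _.
  rewrite (eq_bigr (fun=> d j)) => [|z /eqP -> //].
  rewrite sum_nat_const leq_mul2r; apply/orP; right.
  apply: leq_trans (card_residues (v.1 - j)%R).
  apply/subset_leq_card/subsetP => z.
  by rewrite unfold_in => /eqP/val_inj <-; rewrite inE subKr.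
by rewrite -big_distrr leq_mul2l sum_cover_deg orbT.
Qed.

End Transport.

(** * From balanced coverings to hypergraphs *)

Section DisjointCliques.

Variables (m t r : nat) (B : {set {set 'I_r}}).
Hypothesis covB : covering m t B.

Definition incidence : finType :=
  {p : {set 'I_r} * 'I_r | (p.1 \in B) && (p.2 \in p.1)}.

Definition block_of (p : incidence) : {set 'I_r} := (val p).1.
Definition point_of (p : incidence) : 'I_r := (val p).2.

Definition clique_graph : hypergraph :=
  @Hypergraph incidence
    [set e : {set incidence} | #|e| == m
      & [forall p in e, forall p' in e, block_of p == block_of p']].

Lemma incidence_inj p p' : block_of p = block_of p' -> point_of p = point_of p' -> p = p'.
Proof.
rewrite /block_of /point_of => eq1 eq2; apply: val_inj.
by case: (val p) (val p') eq1 eq2 => b i [b' i'] /= -> ->.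
Qed.

(** The class of [i] has one vertex per block through [i]; a block containing [I] supplies the edge,
    namely its copy of [I]. *)
Lemma clique_graph_rk k : (forall i, cover_deg B i <= k) ->
  rk_hypergraph m r k clique_graph.
Proof.
move=> degB; split=> [e | ]; first by rewrite inE => /andP[/eqP].
exists (fun i => [set p : incidence | point_of p == i]); split.
- move=> i j ne_ij; rewrite -setI_eq0; apply/eqP/setP => p; rewrite !inE.
  by apply/negP => /andP[/eqP-> /eqP eq_ij]; rewrite eq_ij eqxx in ne_ij.
- apply/setP => p; rewrite inE; apply/bigcupP.
  by exists (point_of p) => //; rewrite inE.
- move=> i; apply: leq_trans (degB i).
  rewrite -(@card_in_imset _ _ block_of) => [|p p']; last first.
    by rewrite !inE => /eqP pi /eqP p'i eq_b; apply: incidence_inj; rewrite ?pi.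
  apply/subset_leq_card/subsetP => _ /imsetP[p + ->]; rewrite !inE => /eqP <-.
  exact: (valP p).
move=> I card_I; have [_ /(_ I card_I)[b Bb sub]] := covB.
pose e := [set p : incidence | (block_of p == b) && (point_of p \in I)].
have point_inj : {in e &, injective point_of}.
  move=> p p'; rewrite !inE => /andP[/eqP pb _] /andP[/eqP p'b _].
  by apply: incidence_inj; rewrite pb.
have eI i : i \in I -> exists2 p, p \in e & point_of p = i.
  move=> Ii; have bi : (b \in B) && (i \in b) by rewrite Bb (subsetP sub).
  by exists (exist _ (b, i) bi); rewrite // inE /block_of /point_of /= eqxx.
exists e.
  rewrite inE -(card_in_imset point_inj); apply/andP; split.
    rewrite -card_I; apply/eqP/eq_card => i; apply/imsetP/idP.
      by case=> p; rewrite inE => /andP[_ Ip] ->.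
    by case/eI => p ep <-; exists p.
  apply/forall_inP => p; rewrite inE => /andP[/eqP -> _].
  by apply/forall_inP => p'; rewrite inE eq_sym => /andP[].
move=> i /eI[p ep pi]; apply/eqP/cards1P; exists p; apply/setP => p'.
rewrite in_set1 in_setI; apply/andP/eqP => [[ep'] | ->].
  by rewrite inE => /eqP p'i; apply: point_inj; rewrite ?p'i.
by rewrite ep inE pi.
Qed.

(** Adjacent vertices share their block, so a connected subgraph lies in one block, where vertices
    are determined by their points. *)
Lemma clique_graph_component (F : hypergraph) : hconnected F ->
  has_subgraph F clique_graph -> #|vertex F| <= t.
Proof.
move=> conF [f f_inj f_edge].
have [x _ | F0] := pickP (vertex F); last by rewrite eq_card0.
have same y z : connect (@adjacent F) y z -> block_of (f y) = block_of (f z).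
  case/connectP=> p; elim: p y => [|y' p IHp] y /=; first by move=> _ ->.
  case/andP=> /exists_inP[e Fe /andP[ye y'e]] /IHp{}IHp /IHp <-.
  have := f_edge e Fe; rewrite inE => /andP[_ /forall_inP same_e].
  by have /forall_inP/(_ (f y') (imset_f f y'e))/eqP := same_e _ (imset_f f ye).
have Bx : block_of (f x) \in B by case/andP: (valP (f x)).
have [leB _] := covB; apply: leq_trans (leB _ Bx).
rewrite -(@card_in_imset _ _ (point_of \o f)) => [|y z _ _ /= eq_pt]; last first.
  by apply: f_inj; apply: incidence_inj; rewrite // -(same x y) ?(same x z).
apply/subset_leq_card/subsetP => _ /imsetP[y _ ->] /=.
by rewrite (same x y) //; case/andP: (valP (f y)).
Qed.

Lemma admissible_of_covering (Hs : hypergraph -> Prop) k : 0 < k ->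
    (forall i, cover_deg B i <= k) ->
    (forall F, Hs F -> hconnected F /\ t < #|vertex F|) ->
  admissible m r Hs k.
Proof.
move=> k_gt0 degB HsP; split=> //; exists clique_graph; first exact: clique_graph_rk.
move=> F /HsP[conF]; rewrite ltnNge => /negP big_F sub_F.
by apply: big_F; apply: clique_graph_component.
Qed.

End DisjointCliques.

Lemma admissible_exists (m t r : nat) (Hs : hypergraph -> Prop) : m <= t ->
    (forall F, Hs F -> hconnected F /\ t < #|vertex F|) ->
  exists k, admissible m r Hs k.
Proof.
move=> le_mt HsP; pose B := msub m [set: 'I_r].
(* The successor keeps the bound positive when [r < m] and [B] is empty. *)
exists #|B|.+1; apply: (@admissible_of_covering m t r B) => // [|i].
  split=> [b /msubP[_ ->] // | e card_e]; exists e => //.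
  by apply/msubP; rewrite subsetT.
apply: leqW; apply/subset_leq_card/subsetP => b; rewrite inE.
by case/andP.
Qed.

(** * The upper bound for all large [r] *)

Section Asymptotics.

Local Open Scope ring_scope.

Variables (R : archiRealFieldType) (m' t : nat) (Hs : hypergraph -> Prop).
Local Notation m := m'.+2.
Hypothesis le_mt : (m <= t)%N.
Hypothesis HsP : forall F, Hs F -> hconnected F /\ (t < #|vertex F|)%N.

Let kap : R := 'C(t - 1, m - 1)%:R.

Lemma admissible_transport (n q r : nat) (B : {set {set 'I_n.+1}}) :
    (m <= n.+1)%N -> (1 < q)%N -> coprime q n`! -> (r <= n.+1 * q)%N ->
    covering m t B ->
  admissible m r Hs ((q %/ n.+1).+1 * q ^ m' * (t * #|B|)
    + ('C(n.+1 * q - 1, m - 1) - 'C(n.+1 - 1, m - 1) * q ^ (m - 1))).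
Proof.
move=> le_mN q_gt1 co_q le_r covB.
have cardY : #|{: 'I_n.+1 * 'Z_q}| = (n.+1 * q)%N.
  by rewrite card_prod !card_ord Zp_cast.
have le_rY : (r <= #|{: 'I_n.+1 * 'Z_q}|)%N by rewrite cardY.
pose f (i : 'I_r) : 'I_n.+1 * 'Z_q := enum_val (widen_ord le_rY i).
have f_inj : injective f.
  by move=> i j /enum_val_inj/(congr1 val) /= eq_ij; apply: val_inj.
have covY := covering_transported le_mt q_gt1 co_q covB.
apply: (admissible_of_covering (covering_preim f_inj covY)) => //; last first.
  move=> i; apply: leq_trans (cover_deg_preim _ _ _) _.
  exact: (transported_deg q_gt1 covB).

rewrite addn_gt0 !muln_gt0 expn_gt0 (ltnW q_gt1) /= (leq_trans _ le_mt) //=.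
have : (0 < #|msub m [set: 'I_n.+1]|)%N by rewrite card_msub cardsT card_ord bin_gt0.
case/card_gt0P=> e /msubP[_ card_e]; have [_ /(_ e card_e)[b Bb _]] := covB.
by apply/orP; left; apply/card_gt0P; exists b.
Qed.

(** The identity [u * 'C(u - 1, m - 1) = m * 'C(u, m)], for [t] and for [n.+1], turns the size bound
    on [b] into an average degree. One factor [1 + eps] comes from [b], one from rounding
    [q / n.+1], and the last [eps] from the non-transversals. *)
Lemma transported_bound (n q : nat) (b eps : R) :
    (m <= n.+1)%N -> (0 < q)%N -> 0 <= eps ->
    b * 'C(t, m)%:R <= (1 + eps) * 'C(n.+1, m)%:R -> 0 <= b ->
    (n.+1)%:R <= eps * q%:R -> kap * (m ^ 2)%:R <= eps * (n.+1)%:R ->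
  kap * ((((q %/ n.+1).+1 * q ^ m')%:R * (t%:R * b))
    + ('C(n.+1 * q - 1, m - 1)%:R - ('C(n.+1 - 1, m - 1) * q ^ (m - 1))%:R))
  <= ((1 + eps) * (1 + eps) + eps) * 'C(n.+1 * q - 1, m - 1)%:R.
Proof.
move=> le_mN q_gt0 eps_ge0 le_b b_ge0 le_Nq le_kap.
pose P := ('C(n.+1 - 1, m - 1) * q ^ (m - 1))%N; pose Q := 'C(n.+1 * q - 1, m - 1).
rewrite -/P -/Q.
have kap_gt0 : 0 < kap by rewrite ltr0n bin_gt0 leq_sub2r.
have N_gt0 : 0 < (n.+1)%:R :> R by rewrite ltr0n.
have lePQ : P%:R <= Q%:R :> R by rewrite ler_nat leq_bin_blowup.
have tb_le : kap * (t%:R * b) <= (1 + eps) * ((n.+1)%:R * 'C(n.+1 - 1, m - 1)%:R).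
  have binE u : u%:R * 'C(u - 1, m - 1)%:R = m%:R * 'C(u, m)%:R :> R.
    by rewrite !subn1 -!natrM mul_bin_diag.
  have -> : kap * (t%:R * b) = m%:R * (b * 'C(t, m)%:R).
    by rewrite mulrA [kap * _]mulrC binE; ring.
  by rewrite binE [leRHS]mulrCA ler_wpM2l.
have q_le : ((q %/ n.+1).+1 * q ^ m')%:R * (n.+1)%:R <= (1 + eps) * (q ^ (m - 1))%:R :> R.
  rewrite subn1 /= expnS !natrM mulrAC mulrA ler_wpM2r ?ler0n //.
  rewrite mulrDl mul1r -natrM; apply: le_trans (_ : q%:R + (n.+1)%:R <= _).
    by rewrite -natrD ler_nat mulSn addnC leq_add2r leq_trunc_div.
  by rewrite lerD2l.
have first_le : kap * (((q %/ n.+1).+1 * q ^ m')%:R * (t%:R * b))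
    <= (1 + eps) * ((1 + eps) * P%:R).
  rewrite mulrCA; apply: le_trans (ler_wpM2l (ler0n _ _) tb_le) _.
  rewrite mulrCA ler_wpM2l ?addr_ge0 // /P [in leRHS]natrM.
  by have := ler_wpM2r (ler0n R 'C(n.+1 - 1, m - 1)) q_le; lra.
have second_le : kap * (Q%:R - P%:R) <= eps * Q%:R.
  have := @bin_blowup_ratio R n.+1 q 1 (m - 1) isT.
  rewrite subnKC // -/P -/Q => /(_ le_mN) ratio.
  have m2 : ((m - 1) * m)%:R / (n.+1)%:R <= (m ^ 2)%:R / (n.+1)%:R :> R.
    by rewrite ler_wpM2r ?invr_ge0 ?ler0n // ler_nat -mulnn leq_mul2r leq_subr orbT.
  have {ratio m2} : Q%:R - P%:R <= Q%:R * ((m ^ 2)%:R / (n.+1)%:R) :> R.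
    apply: le_trans (ler_wpM2l (ler0n R Q) m2).
    by move: ratio; rewrite mulrBr mulr1 !lerBlDr addrC.
  move/(ler_wpM2l (ltW kap_gt0)) => /le_trans; apply.
  by rewrite mulrCA mulrC ler_wpM2r ?ler0n // mulrA ler_pdivrMr.
have PQ2 : (1 + eps) * ((1 + eps) * P%:R) <= (1 + eps) * ((1 + eps) * Q%:R).
  by rewrite !ler_wpM2l ?addr_ge0.
by rewrite mulrDr; lra.
Qed.

(** Overshooting [r] by a bounded amount [c] costs only a factor [1 - O(1/r)]. *)
Lemma bin_shift_ratio (a r c : nat) : (m <= r)%N -> (a <= r + c)%N ->
  'C(a - 1, m - 1)%:R * (1 - (m * (m + c))%:R / r%:R) <= 'C(r - 1, m - 1)%:R :> R.
Proof.
move=> le_mr le_a; have r_gt0 : 0 < r%:R :> R by rewrite ltr0n (leq_trans _ le_mr).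
have rc_gt0 : 0 < (r + c)%:R :> R by rewrite natrD ltr_wpDr.
pose y : R := (m + c)%:R / (r + c)%:R.
have y01 : 0 <= y <= 1.
  by rewrite divr_ge0 ?ler0n //= ler_pdivrMr // mul1r ler_nat leq_add2r.
have := expr1B_ge (m - 1) y01.
have -> : 1 - y = (r - m)%:R / (r + c)%:R.
  by rewrite /y -(subnDr c r m) natrB ?leq_add2r // mulrBl divff ?lt0r_neq0.
rewrite expr_div_n => le_pow.
apply: le_trans (_ : 'C(a - 1, m - 1)%:R * ((r - m)%:R ^+ (m - 1) / (r + c)%:R ^+ (m - 1)) <= _).
  rewrite ler_wpM2l ?ler0n //; apply: le_trans le_pow; rewrite lerD2l lerN2 natrM -mulrA.
  apply: ler_pM; rewrite ?ler0n ?(divr_ge0) ?ler0n ?ler_nat ?leq_subr //.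
  by rewrite ler_wpM2l ?ler0n // lef_pV2 ?posrE // ler_nat leq_addr.
rewrite mulrA ler_pdivrMr ?exprn_gt0 // -!natrX -!natrM ler_nat.
have le_Ca : ('C(a - 1, m - 1) * (m - 1)`! <= (r + c) ^ (m - 1))%N.
  apply: leq_trans (leq_bin_exp _ _) _.
  by rewrite leq_exp2r ?subn_gt0 // (leq_trans (leq_subr _ _)).
have le_Cr : ((r - m) ^ (m - 1) <= 'C(r - 1, m - 1) * (m - 1)`!)%N.
  by have := geq_bin_exp (r - 1) (m - 1); rewrite -subnDA subnKC.
rewrite -(@leq_pmul2r (m - 1)`!) ?fact_gt0 // mulnAC.
by apply: leq_trans (leq_mul le_Ca le_Cr) _; apply: eq_leq; ring.
Qed.

Lemma archi_ge (x eps : R) : 0 < eps -> exists n0, forall n, (n0 <= n)%N -> x <= eps * n%:R.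
Proof.
move=> eps_gt0; exists (Num.bound `|x / eps|) => n le_n.
rewrite mulrC -ler_pdivrMr //; apply: le_trans (ler_norm _) _.
by apply: le_trans (ltW (archi_boundP (normr_ge0 _))) _; rewrite ler_nat.
Qed.

Theorem admissible_asymptotic (eps : R) : 0 < eps -> exists r0, forall r, (r0 <= r)%N ->
  exists2 k, admissible m r Hs k
    & k%:R <= (1 + eps) * ('C(r - 1, m - 1)%:R / 'C(t - 1, m - 1)%:R).
Proof.
(* The losses combine to [((1 + e) ^+ 2 + e) / (1 - e)], which is at most [1 + 8 * e] for
   [e <= 1/8]. *)
move=> eps_gt0; pose e := Num.min eps 1 / 8.
have min_gt0 : 0 < Num.min eps 1 by rewrite lt_min eps_gt0 ltr01.
have e_gt0 : 0 < e by rewrite divr_gt0.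
have min_le1 : Num.min eps 1 <= 1 by rewrite ge_min lexx orbT.
have min_leeps : Num.min eps 1 <= eps by rewrite ge_min lexx.
have e_le : 8 * e <= 1 by rewrite /e; lra.
have e_leeps : 8 * e <= eps by rewrite /e; lra.
have kap_gt0 : 0 < kap by rewrite ltr0n bin_gt0 leq_sub2r.
have [n0 n0P] := archi_ge (kap * (m ^ 2)%:R) e_gt0.
have [N [le_n0N [B [covB le_B]]]] :=
  @approximate_covering R m t isT le_mt e (maxn n0 m) e_gt0.
move: le_n0N; rewrite geq_max => /andP[/n0P le_kap le_mN].
case: N le_kap le_mN B covB le_B => // n le_kap le_mN B covB le_B.
pose d := (n.+1 * n`!)%N; pose c := (d + n.+1)%N.
have d_gt0 : (0 < d)%N by rewrite muln_gt0 fact_gt0.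
have [r1 r1P] := archi_ge ((n.+1)%:R * (n.+1)%:R) e_gt0.
have [r2 r2P] := archi_ge (m * (m + c))%:R e_gt0.
exists (maxn m (maxn r1 r2)) => r; rewrite !geq_max => /and3P[le_mr /r1P r1_le /r2P r2_le].
(* Being 1 modulo the factorial of [n], [q] is coprime to it; [n.+1 * q] exceeds [r] by at most [c],
   which does not depend on [r]. *)
pose q := ((r %/ d).+1 * n`! + 1)%N.
have Nq : (n.+1 * q = (r %/ d).+1 * d + n.+1)%N by rewrite /q /d; ring.
have le_r : (r <= n.+1 * q)%N by rewrite Nq ltnW // ltn_addr // ltn_ceil.
have le_Nq : (n.+1 * q <= r + c)%N.
  by rewrite Nq /c mulSn addnA leq_add2r addnC leq_add2r leq_trunc_div.
have q_gt1 : (1 < q)%N by rewrite /q addn1 ltnS muln_gt0 fact_gt0.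
have co_q : coprime q n`! by rewrite /q coprime_sym /coprime gcdnMDl gcdn1.
have N_gt0 : 0 < (n.+1)%:R :> R by rewrite ltr0n.
have le_Neq : (n.+1)%:R <= e * q%:R.
  rewrite -(ler_pM2l N_gt0) mulrCA; apply: le_trans r1_le _.
  by rewrite ler_wpM2l ?(ltW e_gt0) // -natrM ler_nat.
eexists; first exact: admissible_transport le_mN q_gt1 co_q le_r covB.
have le_bound := transported_bound le_mN (ltnW q_gt1) (ltW e_gt0) le_B
  (ler0n _ _) le_Neq le_kap.
rewrite mulrA ler_pdivlMr // -/kap mulrC.
rewrite natrD natrM [(t * _)%:R]natrM natrB ?leq_bin_blowup ?(ltnW q_gt1) //.
apply: le_trans le_bound _.
set Q : R := 'C(n.+1 * q - 1, m - 1)%:R; have Q_ge0 : 0 <= Q by apply: ler0n.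
have le_Q : Q * (1 - e) <= 'C(r - 1, m - 1)%:R.
  apply: le_trans (bin_shift_ratio le_mr le_Nq); rewrite ler_wpM2l // lerD2l lerN2.
  by rewrite ler_pdivrMr // ltr0n (leq_trans _ le_mr).
apply: le_trans (_ : (1 + eps) * (Q * (1 - e)) <= _); last first.
  by rewrite ler_wpM2l // addr_ge0 // ltW.
rewrite mulrCA mulrC ler_wpM2l //.
apply: le_trans (_ : (1 + 8 * e) * (1 - e) <= _); first by nra.
by rewrite ler_wpM2r ?lerD2l //; lra.
Qed.

End Asymptotics.

(* Existence of the minimum and the vanishing error term *)
From mathcomp Require Import boolp classical_sets reals topology normedtype sequences.
Import Order.TTheory GRing.Theory Num.Theory.
Import numFieldNormedType.Exports.

(** Well-ordering by strong induction; excluded middle is used because [Hs] is an arbitrary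
    predicate. *)
Lemma is_f_exists (m r : nat) (Hs : hypergraph -> Prop) k :
  admissible m r Hs k -> exists2 k', is_f m r Hs k' & k' <= k.
Proof.
elim/ltn_ind: k => k IHk adm_k.
case: (pselect (exists2 l, admissible m r Hs l & l < k)) => [[l adm_l lt_lk] | min_k].
  by have [k' fk' le_k'l] := IHk l lt_lk adm_l; exists k'; rewrite // (leq_trans le_k'l) // ltnW.
exists k => //; split=> // l adm_l; rewrite leqNgt; apply/negP => lt_lk.
by apply: min_k; exists l.
Qed.

Local Open Scope classical_set_scope.
Local Open Scope ring_scope.

Theorem theorem1p9 (R : realType) (m t : nat) (Hs : hypergraph -> Prop)
    (m_ge2 : (2 <= m)%N) (t_gem : (m <= t)%N)
    (Hs_prop : forall F, Hs F ->
       [/\ uniform m F, hconnected F & (t < #|vertex F|)%N]) :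
  exists o : nat -> R,
    o @ \oo --> (0 : R) /\
    forall r : nat, (m <= r)%N ->
      exists2 k : nat, is_f m r Hs k
        & k%:R <= (1 + o r) * ('C(r - 1, m - 1)%:R / 'C(t - 1, m - 1)%:R).
Proof.
have HsP F : Hs F -> hconnected F /\ (t < #|vertex F|)%N by case/Hs_prop.
case: m m_ge2 t_gem {Hs_prop} => [|[|m']] // _ le_mt.
have fP r : exists k, is_f m'.+2 r Hs k.
  have [k adm_k] := admissible_exists r le_mt HsP.
  by have [k' fk' _] := is_f_exists adm_k; exists k'.
have [f {}fP] := choice fP.
pose b r : R := 'C(r - 1, m'.+2 - 1)%:R / 'C(t - 1, m'.+2 - 1)%:R.
have b_gt0 r : (m'.+2 <= r)%N -> 0 < b r.
  by move=> le_mr; rewrite divr_gt0 // ltr0n bin_gt0 leq_sub2r.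
(* The positive part of the relative excess: the inequality holds by construction, and since only an
   upper bound is sought, the limit needs no lower bound on [f r]. *)
exists (fun r => Num.max 0 ((f r)%:R / b r - 1)); split; last first.
  move=> r le_mr; exists (f r) => //; rewrite -/(b r) -ler_pdivrMr ?b_gt0 //.
  by rewrite -lerBlDl le_max lexx orbT.
apply/cvgrPdist_le => eps eps_gt0.
have [r0 r0P] := admissible_asymptotic le_mt HsP eps_gt0.
exists (maxn r0 m'.+2) => // r /=; rewrite geq_max => /andP[/r0P[k adm_k le_k] le_mr].
rewrite sub0r normrN ger0_norm; last by rewrite le_max lexx.
rewrite ge_max (ltW eps_gt0) /= lerBlDl ler_pdivrMr ?b_gt0 //.
apply: le_trans le_k; rewrite ler_nat.
by have [_] := fP r; apply.
Qed.
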